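(* Suppose $f$ is twice differentiable with $0\preceq\nabla^2f(x)\preceq LI$ for all $x\in\mathbb{R}^{np}$, where $0<L<\infty$. Let $x(t)$ be the iterates of the synchronous D-BFGS method, and suppose $\tilde v_{n_i}(t)^T\tilde r_{n_i}(t)>0$ for all $i$ and $t$. Let $\Delta=\Gamma+n/\gamma$. If the stepsize $\epsilon(t)>0$ satisfies $\epsilon(t)<2\Gamma/(L\Delta^2)$, then the objective function error $f(x(t))-f(x^* )$ converges to zero at least in the order of $o(1/t)$, i.e. $$f(x(t))-f(x^* )\le o\!\left(\frac1t\right).$$
   Context: Setting. $\mathcal{G}=(\mathcal{V},\mathcal{E})$ is an undirected graph with nodes $\mathcal{V}=\{1,\dots,n\}$; $n_i=\{i\}\cup\{j:(i,j)\in\mathcal{E}\}$ and $m_i=|n_i|$. A vector $z\in\mathbb{R}^{np}$ is split in blocks $z_1,\dots,z_n\in\mathbb{R}^p$; $z_{n_i}\in\mathbb{R}^{m_ip}$ is the concatenation of the blocks $z_j$, $j\in n_i$. For $A\in\mathbb{R}^{np\times np}$, $A_{n_i}\in\mathbb{R}^{m_ip\times m_ip}$ is the submatrix of rows and columns belonging to nodes in $n_i$. The function $f:\mathbb{R}^{np}\to\mathbb{R}$ is such that the block gradient $\nabla_i f(x)=\partial f(x)/\partial x_i$ depends only on $x_{n_i}$, for every $i$, and $f$ has a minimizer $x^*\in\mathbb{R}^{np}$. $D\in\mathbb{R}^{np\times np}$ is block diagonal with $i$th block $m_i^{-1}I_p$. Synchronous D-BFGS. Parameters $\gamma,\Gamma>0$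 and scalar stepsizes $\epsilon(t)$; initial $x(0)\in\mathbb{R}^{np}$ and symmetric invertible matrices $B^i(0)\in\mathbb{R}^{m_ip\times m_ip}$ with $B^i(0)^{-1}$ positive semidefinite. With $g(t)=\nabla f(x(t))$, at each $t=0,1,2,\dots$ and for each node $i$: $$e^i_{n_i}(t)=-\big(B^i(t)^{-1}+\Gamma D_{n_i}\big)g_{n_i}(t),\qquad d_i(t)=\sum_{j\in n_i}e^j_i(t),\qquad x_i(t+1)=x_i(t)+\epsilon(t)d_i(t),$$ where $e^j_i(t)\in\mathbb{R}^p$ is the block of $e^j_{n_j}(t)$ corresponding to node $i$. Then $$\tilde v_{n_i}(t)=D_{n_i}[x_{n_i}(t+1)-x_{n_i}(t)],\qquad \tilde r_{n_i}(t)=g_{n_i}(t+1)-g_{n_i}(t)-\gamma\tilde v_{n_i}(t),$$ $$B^i(t+1)=B^i(t)+\frac{\tilde r_{n_i}(t)\tilde r_{n_i}(t)^T}{\tilde r_{n_i}(t)^T\tilde v_{n_i}(t)}-\frac{B^i(t)\tilde v_{n_i}(t)\tilde v_{n_i}(t)^TB^i(t)}{\tilde v_{n_i}(t)^TB^i(t)\tilde v_{n_i}(t)}+\gamma I .$$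
   Formalization: The stepsizes are assumed bounded below by a positive constant, ε(t) ≥ ε₀ > 0 for all t, instead of merely ε(t) > 0; with summable stepsizes such as ε(t) = c·2^{-t} and f(x) = x²/2 the error does not converge to zero. *)

(* Defs.v *)
From HB Require Import structures.
From mathcomp Require Import all_boot all_order all_algebra.
From mathcomp Require Import all_classical all_reals all_analysis.
Set Implicit Arguments.
Unset Strict Implicit.
Unset Printing Implicit Defensive.
Import Order.TTheory GRing.Theory Num.Theory.
Import numFieldNormedType.Exports.
Local Open Scope classical_set_scope.
Local Open Scope ring_scope.

(* The space R^(np) of n stacked blocks of R^p is 'cV[R]_(bdim n p).  The
   dimension is written as a sum so that the block-matrix operations of
   matrix.v (submxcol, submxblock, \mxcol, \mxblock, \mxdiag) apply to it. *)
Notation bdim n p := (\sum_(i < n) p)%N.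

Definition gradient (R : realType) (N : nat) (f : 'cV[R]_N -> R^o)
    (x : 'cV[R]_N) : 'cV[R]_N :=
  \col_k 'D_(delta_mx k 0) f x.

Definition hessian (R : realType) (N : nat) (f : 'cV[R]_N -> R^o)
    (x : 'cV[R]_N) : 'M[R]_N :=
  \matrix_(k, l) 'D_(delta_mx l 0) (fun y => gradient f y k 0 : R^o) x.

Definition twice_differentiable (R : realType) (N : nat)
    (f : 'cV[R]_N -> R^o) : Prop :=
  (forall x, differentiable f x) /\ (forall x, differentiable (gradient f) x).

Definition vdot (R : realType) (N : nat) (u w : 'cV[R]_N) : R :=
  (u^T *m w) 0 0.

(* Only applied to symmetric matrices; symmetry of Hessians is not assumed, as
   it follows from twice differentiability. *)
Definition psdmx (R : realType) (N : nat) (A : 'M[R]_N) : Prop :=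
  forall u : 'cV[R]_N, 0 <= vdot u (A *m u).

Definition loewner_le (R : realType) (N : nat) (A B : 'M[R]_N) : Prop :=
  psdmx (B - A).

Definition nbhd (n : nat) (E : rel 'I_n) (i : 'I_n) : {set 'I_n} :=
  i |: [set j | E i j].

Definition nbhd_size (n : nat) (E : rel 'I_n) (i : 'I_n) : nat := #|nbhd E i|.

(* Blocks local to a set S of nodes are numbered by 'I_#|S|, the a-th one
   belonging to the node enum_val a, i.e. in increasing order of the nodes. *)
Definition subvec (R : realType) (n p : nat) (S : {set 'I_n})
    (z : 'cV[R]_(bdim n p)) : 'cV[R]_(bdim #|S| p) :=
  \mxcol_(a < #|S|) submxcol z (enum_val a).

Definition submat (R : realType) (n p : nat) (S : {set 'I_n})
    (A : 'M[R]_(bdim n p)) : 'M[R]_(bdim #|S| p) :=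
  \mxblock_(a < #|S|, b < #|S|) submxblock A (enum_val a) (enum_val b).

(* For i \in S the sum has exactly one term. *)
Definition node_block (R : realType) (n p : nat) (S : {set 'I_n})
    (u : 'cV[R]_(bdim #|S| p)) (i : 'I_n) : 'cV[R]_p :=
  \sum_(a < #|S| | enum_val a == i) submxcol u a.

Definition Dmat (R : realType) (n p : nat) (E : rel 'I_n) :
    'M[R]_(bdim n p) :=
  \mxdiag_(i < n) ((nbhd_size E i)%:R^-1)%:M.

Definition local_dir (R : realType) (n p : nat) (E : rel 'I_n) (Gam : R)
    (g : 'cV[R]_(bdim n p)) (i : 'I_n)
    (B : 'M[R]_(bdim #|nbhd E i| p)) : 'cV[R]_(bdim #|nbhd E i| p) :=
  - ((invmx B + Gam *: submat (nbhd E i) (Dmat R p E))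
       *m subvec (nbhd E i) g).

Definition descent_dir (R : realType) (n p : nat) (E : rel 'I_n) (Gam : R)
    (g : 'cV[R]_(bdim n p)) (B : forall i, 'M[R]_(bdim #|nbhd E i| p))
    (i : 'I_n) : 'cV[R]_p :=
  \sum_(j in nbhd E i) node_block (local_dir Gam g (B j)) i.

Definition vtilde (R : realType) (n p : nat) (E : rel 'I_n)
    (x : nat -> 'cV[R]_(bdim n p)) (t : nat) (i : 'I_n) :
    'cV[R]_(bdim #|nbhd E i| p) :=
  submat (nbhd E i) (Dmat R p E)
    *m (subvec (nbhd E i) (x t.+1) - subvec (nbhd E i) (x t)).

Definition rtilde (R : realType) (n p : nat) (E : rel 'I_n)
    (f : 'cV[R]_(bdim n p) -> R^o) (gam : R)
    (x : nat -> 'cV[R]_(bdim n p)) (t : nat) (i : 'I_n) :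
    'cV[R]_(bdim #|nbhd E i| p) :=
  subvec (nbhd E i) (gradient f (x t.+1))
    - subvec (nbhd E i) (gradient f (x t)) - gam *: vtilde E x t i.

Definition bfgs_update (R : realType) (N : nat) (gam : R) (B : 'M[R]_N)
    (v r : 'cV[R]_N) : 'M[R]_N :=
  B + (vdot r v)^-1 *: (r *m r^T)
    - (vdot v (B *m v))^-1 *: (B *m v *m v^T *m B)
    + gam%:M.

Definition DBFGS_iterates (R : realType) (n p : nat) (E : rel 'I_n)
    (f : 'cV[R]_(bdim n p) -> R^o) (gam Gam : R) (eps : nat -> R)
    (x : nat -> 'cV[R]_(bdim n p))
    (B : nat -> forall i, 'M[R]_(bdim #|nbhd E i| p)) : Prop :=
  (forall i, [/\ (B 0%N i)^T = B 0%N i, B 0%N i \in unitmx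
               & psdmx (invmx (B 0%N i))]) /\
  (forall t i,
     submxcol (x t.+1) i = submxcol (x t) i
       + eps t *: descent_dir Gam (gradient f (x t)) (B t) i /\
     B t.+1 i =
       bfgs_update gam (B t i) (vtilde E x t i) (rtilde E f gam x t i)).

(* Main.v *)
Require Import Defs.
From HB Require Import structures.
From mathcomp Require Import all_boot all_order all_algebra.
From mathcomp Require Import all_classical all_reals all_analysis.
From mathcomp Require Import ring lra zify.
Import Order.TTheory GRing.Theory Num.Theory.
Import numFieldNormedType.Exports.
Local Open Scope classical_set_scope.
Local Open Scope ring_scope.

(** From the first update on, every local matrix dominates gam I.  The blocks
    therefore assemble into steps along - H g, where g is the gradient at the
    current point, H is symmetric and Gam I <= H <= Delta I.  With the bound on
    the stepsizes this makes f decrease by at least c1 |g|^2 along a step of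
    length at most C2 |g|.  The matrices H may change arbitrarily from one step
    to the next, so the distance to a minimizer need not decrease and the usual
    telescoping of squared distances fails.  What replaces it is a geometric
    fact: the path of the iterates has finite length.

    Let nu t be the normalized gradient at x t.  Convexity and sufficient
    decrease give, for all t < s,

      nu t . (x s - x t) <= - c |x (t+1) - x t|,

    and the same with a minimizer in place of x s.  Call [depth t' t] the
    quantity nu t . (x t' - x t) + c |x (t+1) - x t|: all that follows t lies at
    least that far below x t' in the direction nu t.  [window_deep] says that
    every time window contains a depth proportional to its length.  The proof
    goes by downward induction on the number m of orthonormal directions to
    which all normals of the window are almost orthogonal; no unit normal is
    almost orthogonal to a whole basis.  For the induction step [deep_step], cut
    the window into minimal pieces that violate the assumption for m + 1.  By
    induction, each piece has a depth proportional to its length.  Moreover the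
    normals of a piece detect every displacement transversal to the m given
    directions, so that a suitable sum of them ([sum_normals]), used as a small
    correction of the normal that carries the depth, turns it into a direction
    with two properties ([piece_direction]): all later points are lower by about
    the depth of the piece plus a fixed multiple of their transversal distance,
    and no point of the whole window is higher by more than about a multiple of
    the largest depth in the window.  The slack proportional to the distance allows
    the direction to be rounded to a finite net that does not depend on the
    piece.  The pieces rounded to the same element of the net have depths that
    telescope, and the sum is at most a multiple of the largest depth.

    If the path were unbounded, the depths found between its first exits from
    balls of geometrically growing radii would provide infinitely many unit
    vectors at mutual distances bounded below ([bounded_path]).  Boundedness and
    [window_deep] give finite length.

    Let d t be the error f (x t) - min f, and tau t the length of the path
    after t.  By convexity and since d tends to 0, d t <= |g t| tau t, and
    sufficient decrease yields 1 / d (t+1) - 1 / d t >= c1 / (tau t)^2.  The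
    right-hand side tends to infinity, hence so does 1 / (t d t)
    ([little_o_rate]). *)

Set Implicit Arguments.
Unset Strict Implicit.
Unset Printing Implicit Defensive.

(** * The Euclidean product and norm *)

Section Euclid.
Variables (R : realType) (N : nat).
Implicit Types u v w : 'cV[R]_N.

Lemma vdotE u w : vdot u w = \sum_k u k 0 * w k 0.
Proof. by rewrite /vdot mxE; apply: eq_bigr => k _; rewrite mxE. Qed.

Lemma vdotC u w : vdot u w = vdot w u.
Proof. by rewrite !vdotE; apply: eq_bigr => k _; rewrite mulrC. Qed.

Lemma vdotDl u v w : vdot (u + v) w = vdot u w + vdot v w.
Proof. by rewrite /vdot linearD mulmxDl mxE. Qed.

Lemma vdotNl u w : vdot (- u) w = - vdot u w.
Proof. by rewrite /vdot linearN mulNmx mxE. Qed.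

Lemma vdotZl a u w : vdot (a *: u) w = a * vdot u w.
Proof. by rewrite /vdot linearZ -scalemxAl mxE. Qed.

Lemma vdotBl u v w : vdot (u - v) w = vdot u w - vdot v w.
Proof. by rewrite vdotDl vdotNl. Qed.

Lemma vdotDr u v w : vdot u (v + w) = vdot u v + vdot u w.
Proof. by rewrite vdotC vdotDl !(vdotC _ u). Qed.

Lemma vdotNr u w : vdot u (- w) = - vdot u w.
Proof. by rewrite vdotC vdotNl vdotC. Qed.

Lemma vdotZr a u w : vdot u (a *: w) = a * vdot u w.
Proof. by rewrite vdotC vdotZl vdotC. Qed.

Lemma vdotBr u v w : vdot u (v - w) = vdot u v - vdot u w.
Proof. by rewrite vdotDr vdotNr. Qed.

Lemma vdot0l w : vdot 0 w = 0.
Proof. by rewrite -(scale0r w) vdotZl mul0r. Qed.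

Lemma vdot0r w : vdot w 0 = 0.
Proof. by rewrite vdotC vdot0l. Qed.

Lemma vdot_suml (I : Type) (s : seq I) (P : pred I) (F : I -> 'cV[R]_N) w :
  vdot (\sum_(i <- s | P i) F i) w = \sum_(i <- s | P i) vdot (F i) w.
Proof. by elim/big_rec2: _ => [|i a b _ <-]; rewrite ?vdot0l ?vdotDl. Qed.

Lemma vdot_sumr (I : Type) (s : seq I) (P : pred I) (F : I -> 'cV[R]_N) w :
  vdot w (\sum_(i <- s | P i) F i) = \sum_(i <- s | P i) vdot w (F i).
Proof. by rewrite vdotC vdot_suml; apply: eq_bigr => i _; rewrite vdotC. Qed.

Lemma vdot_ge0 u : 0 <= vdot u u.
Proof. by rewrite vdotE sumr_ge0// => k _; rewrite -expr2 sqr_ge0. Qed.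

Lemma vdot_eq0 u : vdot u u = 0 -> u = 0.
Proof.
rewrite vdotE => /eqP; rewrite psumr_eq0; last first.
  by move=> k _; rewrite -expr2 sqr_ge0.
move=> /allP h; apply/matrixP => k j; rewrite ord1 mxE; apply/eqP.
by have := h k (mem_index_enum _); rewrite /= mulf_eq0 orbb.
Qed.

(** Stated for any symmetric positive semidefinite form, since it serves the
    Euclidean product as well as the quasi-Newton matrices. *)
Lemma form_CauchySchwarz (a : 'cV[R]_N -> 'cV[R]_N -> R)
    (aD : forall u v w, a (u + v) w = a u w + a v w)
    (aZ : forall c u w, a (c *: u) w = c * a u w)
    (aC : forall u w, a u w = a w u) (a_ge0 : forall u, 0 <= a u u) u w :
  a u w ^+ 2 <= a u u * a w w.
Proof.
have q s t : 0 <= s ^+ 2 * a u u + 2 * (s * t * a u w) + t ^+ 2 * a w w.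
  have h := a_ge0 (s *: u + t *: w); apply: le_trans h _.
  rewrite aD !aZ (aC u (_ + _)) (aC w (_ + _)) !aD !aZ (aC w u).
  by rewrite le_eqVlt; apply/orP; left; apply/eqP; ring.
have [w0|w0] := eqVneq (a w w) 0.
  rewrite w0 mulr0; have [-> //|h] := eqVneq (a u w) 0; first by rewrite expr0n.
  have := q (1 : R) (- (a u u + 1) / (2 * a u w)); rewrite w0 mulr0 addr0.
  have -> : 1 ^+ 2 * a u u + 2 * (1 * (- (a u u + 1) / (2 * a u w)) * a u w) = -1.
    by field.
  lra.
have := q (a w w) (- a u w).
have -> : a w w ^+ 2 * a u u + 2 * (a w w * - a u w * a u w)
  + (- a u w) ^+ 2 * a w w = a w w * (a u u * a w w - a u w ^+ 2) by ring.
by rewrite pmulr_rge0 ?subr_ge0// lt_def w0 a_ge0.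
Qed.

Lemma vdot_CauchySchwarz u w : vdot u w ^+ 2 <= vdot u u * vdot w w.
Proof.
apply: form_CauchySchwarz; first exact: vdotDl; first exact: vdotZl.
  exact: vdotC.
exact: vdot_ge0.
Qed.

(** The Euclidean norm; the canonical norm of matrices is the sup norm. *)
Definition nrm u : R := Num.sqrt (vdot u u).

Lemma nrm_ge0 u : 0 <= nrm u. Proof. exact: sqrtr_ge0. Qed.

Lemma nrm_sqr u : nrm u ^+ 2 = vdot u u.
Proof. by rewrite sqr_sqrtr// vdot_ge0. Qed.

Lemma nrm0 : nrm 0 = 0. Proof. by rewrite /nrm vdot0l sqrtr0. Qed.

Lemma nrm_eq0 u : nrm u = 0 -> u = 0.
Proof. by move=> h; apply: vdot_eq0; rewrite -nrm_sqr h expr0n. Qed.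

Lemma nrmZ a u : nrm (a *: u) = `|a| * nrm u.
Proof.
rewrite /nrm vdotZl vdotZr mulrA -expr2 sqrtrM ?sqr_ge0//.
by rewrite sqrtr_sqr.
Qed.

Lemma nrmN u : nrm (- u) = nrm u.
Proof. by rewrite /nrm vdotNl vdotNr opprK. Qed.

Lemma vdot_norm u w : `|vdot u w| <= nrm u * nrm w.
Proof.
rewrite -ler_sqr ?nnegrE ?mulr_ge0 ?nrm_ge0// real_normK ?num_real// exprMn !nrm_sqr.
exact: vdot_CauchySchwarz.
Qed.

Lemma vdot_le u w : vdot u w <= nrm u * nrm w.
Proof. exact: le_trans (ler_norm _) (vdot_norm _ _). Qed.

Lemma nrmD u w : nrm (u + w) <= nrm u + nrm w.
Proof.
rewrite -ler_sqr ?nnegrE ?addr_ge0 ?nrm_ge0// nrm_sqr sqrrD !nrm_sqr.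
rewrite vdotDl !vdotDr (vdotC w u).
have := vdot_le u w; lra.
Qed.

Lemma nrm_sum (I : Type) (s : seq I) (P : pred I) (F : I -> 'cV[R]_N) :
  nrm (\sum_(i <- s | P i) F i) <= \sum_(i <- s | P i) nrm (F i).
Proof.
elim/big_rec2: _ => [|i a b _ h]; first by rewrite nrm0.
by apply: le_trans (nrmD _ _) _; rewrite lerD2l.
Qed.

End Euclid.

(** * Finite nets and orthogonal projections *)

Section Nets.
Variables (R : realType) (N : nat).
Implicit Types u v w : 'cV[R]_N.

Lemma coord_le_nrm u k : `|u k 0| <= nrm u.
Proof.
rewrite -ler_sqr ?nnegrE ?nrm_ge0// real_normK ?num_real// nrm_sqr vdotE.
by rewrite (bigD1 k)//= -expr2 lerDl sumr_ge0// => i _; rewrite -expr2 sqr_ge0.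
Qed.

Lemma nrm_le_coord u h : 0 <= h -> (forall k, `|u k 0| <= h) ->
  nrm u <= N.+1%:R * h.
Proof.
move=> h0 uh; rewrite -ler_sqr ?nnegrE ?nrm_ge0 ?mulr_ge0// nrm_sqr vdotE.
apply: (@le_trans _ _ (\sum_(k < N) h ^+ 2)).
  apply: ler_sum => k _.
  by rewrite -expr2 -[leLHS]real_normK ?num_real// ler_sqr ?nnegrE.
rewrite sumr_const card_ord exprMn -[leLHS]mulr_natl ler_wpM2r ?sqr_ge0//.
by rewrite -natrX ler_nat; lia.
Qed.

(** A cubic grid. *)
Lemma finite_net (r eps : R) : 0 < eps ->
  exists (T : finType) (z : T -> 'cV[R]_N),
    forall v, nrm v <= r -> exists i, nrm (v - z i) <= eps.
Proof.
move=> eps0.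
have N0 : (0 : R) < N.+1%:R by rewrite ltr0n.
pose h := eps / N.+1%:R.
have h0 : 0 < h by rewrite divr_gt0.
pose L := Num.trunc (2 * r / h).
exists {ffun 'I_N -> 'I_L.+1}, (fun f : {ffun 'I_N -> 'I_L.+1} =>
  \col_(k < N) (- r + h * (f k : nat)%:R)) => v vr.
pose c k := (v k 0 + r) / h.
have vk k : - r <= v k 0 <= r.
  by rewrite -ler_norml (le_trans (coord_le_nrm _ _)).
have c0 k : 0 <= c k.
  by rewrite divr_ge0 ?(ltW h0)//; have /andP[] := vk k; lra.
have cL k : (Num.trunc (c k) < L.+1)%N.
  rewrite ltnS; apply: le_truncn; rewrite ler_pM2r ?invr_gt0//.
  by have /andP[] := vk k; lra.
exists [ffun k => Ordinal (cL k)].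
have -> : eps = N.+1%:R * h by rewrite /h mulrCA divff ?mulr1 ?gt_eqF.
apply: nrm_le_coord (ltW h0) _ => k; rewrite !mxE ffunE /=.
have /andP[h1 h2] := truncn_itv (c0 k).
have -> : v k 0 = c k * h - r by rewrite /c divfK ?gt_eqF//; ring.
set m := (Num.trunc _)%:R in h1 *.
have -> : c k * h - r - (- r + h * m) = h * (c k - m) by ring.
rewrite normrM (gtr0_norm h0) ger_pMr// ger0_norm ?subr_ge0//.
move: h2; rewrite -natr1 -/m; lra.
Qed.

End Nets.

Section Projection.
Variables (R : realType) (N m : nat).
Implicit Types (u y : 'cV[R]_N).

Lemma vdot_mulmxl (A : 'M[R]_(m, N)) u (w : 'cV[R]_m) :
  vdot (A *m u) w = vdot u (A^T *m w).
Proof. by rewrite /vdot trmx_mul mulmxA. Qed.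

Variable E : 'M[R]_(m, N).
Hypothesis EE : E *m E^T = 1%:M.

(** The orthogonal projection onto the kernel of a matrix whose rows are
    orthonormal. *)
Definition kproj y : 'cV[R]_N := y - E^T *m (E *m y).

Lemma kproj_ker y : E *m kproj y = 0.
Proof. by rewrite /kproj mulmxBr (mulmxA E) EE mul1mx subrr. Qed.

Lemma kprojB y z : kproj (y - z) = kproj y - kproj z.
Proof. by rewrite /kproj !mulmxBr opprD addrACA -opprD. Qed.

Lemma vdot_kproj u y :
  vdot u (kproj y) = vdot u y - vdot (E *m u) (E *m y).
Proof. by rewrite /kproj vdotBr vdot_mulmxl. Qed.

Lemma nrm_mulmx_le y : nrm (E *m y) <= nrm y.
Proof.
rewrite -ler_sqr ?nnegrE ?nrm_ge0// !nrm_sqr -subr_ge0 -vdot_kproj.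
have := vdot_ge0 (kproj y).
by rewrite vdot_kproj kproj_ker vdot0l subr0 vdotC.
Qed.

Lemma vdot_kproj_close u y eta : nrm (E *m u) <= eta ->
  `|vdot u (kproj y) - vdot u y| <= eta * nrm y.
Proof.
move=> h; rewrite vdot_kproj addrAC subrr add0r normrN.
apply: le_trans (vdot_norm _ _) _.
by apply: ler_pM; rewrite ?nrm_ge0 ?nrm_mulmx_le.
Qed.

Lemma orthonormal_col_mx e : E *m e = 0 -> nrm e = 1 ->
  col_mx e^T E *m (col_mx e^T E)^T = 1%:M.
Proof.
move=> Ee e1; rewrite tr_col_mx mul_col_row trmxK EE Ee.
have -> : e^T *m E^T = 0 by rewrite -trmx_mul Ee trmx0.
have -> : e^T *m e = 1%:M.
  apply/matrixP => i j; rewrite !ord1 [RHS]mxE eqxx.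
  by rewrite -[LHS]/(vdot e e) -nrm_sqr e1 expr1n.
by rewrite -scalar_mx_block.
Qed.

Lemma nrm_col_mx_sqr e u :
  nrm (col_mx e^T E *m u) ^+ 2 = vdot e u ^+ 2 + nrm (E *m u) ^+ 2.
Proof.
rewrite !nrm_sqr mul_col_mx !vdotE big_split_ord /= big_ord1; congr (_ + _).
  by rewrite !col_mxEu -expr2; congr (_ ^+ 2); rewrite -vdotE.
by apply: eq_bigr => k _; rewrite !col_mxEd.
Qed.

End Projection.

(** * The length of a descending path *)

Section Descent.
Variables (R : realType) (N : nat) (x nu : nat -> 'cV[R]_N) (c : R).

Definition step t : R := nrm (x t.+1 - x t).
Definition len b e : R := \sum_(b <= t < e) step t.

Lemma step_ge0 t : 0 <= step t. Proof. exact: nrm_ge0. Qed.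

Lemma len_ge0 b e : 0 <= len b e.
Proof. by rewrite sumr_ge0// => t _; exact: step_ge0. Qed.

Lemma len_cat b a e : (b <= a <= e)%N -> len b e = len b a + len a e.
Proof. by case/andP=> h1 h2; rewrite /len (@big_cat_nat _ _ _ a). Qed.

Lemma len1 t : len t t.+1 = step t. Proof. exact: big_nat1. Qed.

Lemma len_sub b a e d : (b <= a)%N -> (a <= e)%N -> (e <= d)%N ->
  len a e <= len b d.
Proof.
move=> h1 h2 h3; rewrite (@len_cat b a d) ?(@len_cat a e d) ?h1 ?h2//.
  have := len_ge0 b a; have := len_ge0 e d; lra.
exact: leq_trans h3.
Qed.

Lemma dist_len b e : (b <= e)%N -> nrm (x e - x b) <= len b e.
Proof.
move=> be; rewrite -(@telescope_sumr _ b e x)//; exact: nrm_sum.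
Qed.

Lemma dist_len_window b e s t : (b <= s <= e)%N -> (b <= t <= e)%N ->
  nrm (x s - x t) <= len b e.
Proof.
wlog st : s t / (t <= s)%N.
  move=> h hs ht; case/orP: (leq_total t s) => [|st]; first by move=> ?; exact: h.
  by rewrite -nrmN opprB; exact: h.
move=> /andP[bs se] /andP[bt te]; apply: le_trans (dist_len st) _.
exact: len_sub.
Qed.

Hypothesis c_gt0 : 0 < c.
Hypothesis nu1 : forall t, nrm (nu t) = 1.
Hypothesis nu_future : forall t s, (t < s)%N ->
  vdot (nu t) (x s - x t) <= - (c * step t).

(** How far below [x t'], in the direction [nu t], the path stays after [t]; see
    [future_below]. *)
Definition depth t' t : R := vdot (nu t) (x t' - x t) + c * step t.

Lemma future_below t' t s : (t < s)%N ->
  vdot (nu t) (x s - x t') <= - depth t' t.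
Proof.
move=> ts; have -> : x s - x t' = (x s - x t) - (x t' - x t).
  by rewrite opprB addrA subrK.
by rewrite vdotBr /depth; have := nu_future ts; lra.
Qed.

Lemma vdot_nu_le t y : vdot (nu t) y <= nrm y.
Proof. by apply: le_trans (vdot_le _ _) _; rewrite nu1 mul1r. Qed.

(** The normals of the window are almost orthogonal to [m] orthonormal
    directions, the rows of [E]. *)
Definition thin m (eta : R) b e := exists E : 'M[R]_(m, N),
  E *m E^T = 1%:M /\ forall t, (b <= t < e)%N -> nrm (E *m nu t) <= eta.

Definition deep m (eta kap : R) := forall b e, (b < e)%N -> thin m eta b e ->
  exists t' t, [/\ (b <= t')%N, (t' <= t)%N, (t < e)%N &
                   kap * len b e <= depth t' t].

(** A unit vector cannot be almost orthogonal to an orthonormal basis. *)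
Lemma deep_full : deep N (1 / 2) 1.
Proof.
move=> b e be [E [EE /(_ b)]]; rewrite leqnn be => /(_ isT) h.
have : nrm (E *m nu b) ^+ 2 = 1.
  by rewrite nrm_sqr vdot_mulmxl mulmxA (mulmx1C EE) mul1mx -nrm_sqr nu1 expr1n.
by have := nrm_ge0 (E *m nu b); nra.
Qed.

Section Window.
Variables (m : nat) (E : 'M[R]_(m, N)) (EE : E *m E^T = 1%:M).
Variables (a a' : nat) (eta th : R).
Hypotheses (eta_ge0 : 0 <= eta) (eta_th : eta <= th) (th_gt0 : 0 < th).
Hypothesis aa' : (a < a')%N.
Hypothesis E_thin : forall t, (a <= t < a')%N -> nrm (E *m nu t) <= eta.

(** A direction of the kernel of [E] to which all normals of the window are
    almost orthogonal could be appended to [E]. *)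
Lemma fat_window : ~ thin m.+1 (2 * th) a a' -> forall u, E *m u = 0 -> u != 0 ->
  exists2 t, (a <= t < a')%N & th * nrm u <= `|vdot (nu t) u|.
Proof.
move=> nthin u Eu u0; apply/not_exists2P => H; apply: nthin.
have nu0 : 0 < nrm u.
  by rewrite lt_def nrm_ge0 andbT; apply: contra_neq u0; exact: nrm_eq0.
pose e := (nrm u)^-1 *: u.
have e1 : nrm e = 1 by rewrite nrmZ gtr0_norm ?invr_gt0// mulVf ?gt_eqF.
have Ee : E *m e = 0 by rewrite -scalemxAr Eu scaler0.
exists (col_mx e^T E); split; first exact: orthonormal_col_mx.
move=> t ht; have := H t; rewrite ht => -[//|/negP]; rewrite -ltNge => h.
have h' : `|vdot e (nu t)| < th.
  by rewrite vdotC vdotZr normrM gtr0_norm ?invr_gt0// mulrC ltr_pdivrMr.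
rewrite -ler_sqr ?nnegrE ?nrm_ge0//; last by rewrite mulr_ge0// ltW.
rewrite (nrm_col_mx_sqr E e (nu t)).
rewrite -[vdot e (nu t) ^+ 2]real_normK ?num_real//.
have : `|vdot e (nu t)| ^+ 2 <= th ^+ 2 by rewrite ler_sqr ?nnegrE// ltW.
have : nrm (E *m nu t) ^+ 2 <= th ^+ 2.
  rewrite ler_sqr ?nnegrE ?nrm_ge0// ?(ltW th_gt0)//.
  exact: le_trans (E_thin ht) eta_th.
by rewrite exprMn; have := sqr_ge0 th; lra.
Qed.

Variables (T : finType) (z : T -> 'cV[R]_N).
Hypothesis z_net : forall v, nrm v <= 1 -> exists i, nrm (v - z i) <= th / 4.
Hypothesis fat : forall u, E *m u = 0 -> u != 0 ->
  exists2 t, (a <= t < a')%N & th * nrm u <= `|vdot (nu t) u|.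

Let M : R := #|T|%:R.

(** If all normals of the window give [y] a height at most [D], then a single
    combination of them gives [y] a height that decreases with the size of
    [kproj E y]: each term satisfies h = 2 h^+ - |h| <= 2 D - |h|, and one of the
    chosen normals sees the direction of [kproj E y], because [fat] provides a
    normal that sees it and [z] approximates it.  Choosing at most one normal
    per element of the net keeps the number of terms independent of the
    window. *)
Lemma sum_normals : exists w0, [/\ nrm w0 <= M, nrm (E *m w0) <= M * eta &
  forall y D, 0 <= D -> (forall t, (a <= t < a')%N -> vdot (nu t) y <= D) ->
    vdot w0 y <= 2 * M * D - th / 4 * nrm (kproj E y) + eta * nrm y].
Proof.
have [f fP] : {f : T -> 'cV[R]_N & forall i,
    (f i = 0 \/ exists2 t, (a <= t < a')%N & f i = nu t) /\
    ((exists2 t, (a <= t < a')%N & th / 2 <= `|vdot (nu t) (z i)|) ->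
      th / 2 <= `|vdot (f i) (z i)|)}.
  apply: (@choice _ _ (fun i v => (v = 0 \/ exists2 t, (a <= t < a')%N & v = nu t) /\
    ((exists2 t, (a <= t < a')%N & th / 2 <= `|vdot (nu t) (z i)|) ->
      th / 2 <= `|vdot v (z i)|))) => i.
  have [[t ht h]|h] :=
      pselect (exists2 t, (a <= t < a')%N & th / 2 <= `|vdot (nu t) (z i)|).
    by exists (nu t); split=> //; right; exists t.
  by exists 0; split => [|//]; left.
have sum_const (K : R) (g : T -> R) : (forall i, g i <= K) -> \sum_i g i <= M * K.
  move=> h; apply: le_trans (ler_sum _ (fun i _ => h i)) _.
  by rewrite sumr_const -mulr_natl.
exists (\sum_i f i); split.
- apply: le_trans (nrm_sum _ _ _) _; rewrite -[M]mulr1; apply: sum_const => i.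
  by have [[->|[t _ ->]] _] := fP i; rewrite ?nrm0// nu1.
- rewrite mulmx_sumr; apply: le_trans (nrm_sum _ _ _) _; apply: sum_const => i.
  by have [[->|[t ht ->]] _] := fP i; rewrite ?mulmx0 ?nrm0//; exact: E_thin.
move=> y D D0 yD; rewrite vdot_suml.
have h1 i : vdot (f i) y + `|vdot (f i) y| <= 2 * D.
  have : vdot (f i) y <= D.
    by have [[->|[t ht ->]] _] := fP i; rewrite ?vdot0l//; exact: yD.
  by case: (ger0P (vdot (f i) y)); lra.
have h2 : \sum_i vdot (f i) y + \sum_i `|vdot (f i) y| <= M * (2 * D).
  by rewrite -big_split /=; apply: sum_const => i; exact: h1.
suff h3 : th / 4 * nrm (kproj E y) <= \sum_i `|vdot (f i) y| + eta * nrm y.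
  by move: h2 h3; lra.
have [->|py0] := eqVneq (kproj E y) 0.
  by rewrite nrm0 mulr0 addr_ge0 ?mulr_ge0 ?nrm_ge0 ?sumr_ge0.
have p0 : 0 < nrm (kproj E y).
  by rewrite lt_def nrm_ge0 andbT; apply: contra_neq py0; exact: nrm_eq0.
set p := kproj E y in py0 p0 *.
pose u := (nrm p)^-1 *: p.
have u1 : nrm u = 1 by rewrite nrmZ gtr0_norm ?invr_gt0// mulVf ?gt_eqF.
have Eu : E *m u = 0 by rewrite -scalemxAr kproj_ker ?scaler0.
have u0 : u != 0 by apply: contra_eq_neq u1 => ->; rewrite nrm0 eq_sym oner_eq0.
have [t ht tu] := fat Eu u0; rewrite u1 mulr1 in tu.
have [i zi] : exists i, nrm (u - z i) <= th / 4 by apply: z_net; rewrite u1.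
have close v : nrm v <= 1 -> `|vdot v u - vdot v (z i)| <= th / 4.
  move=> v1; rewrite -vdotBr; apply: le_trans (vdot_norm _ _) _.
  apply: le_trans zi; by rewrite ler_piMl ?nrm_ge0.
have ftz : th / 2 <= `|vdot (f i) (z i)|.
  apply: (fP i).2; exists t => //.
  have := close (nu t); rewrite nu1 lexx => /(_ isT).
  have := ler_normD (vdot (nu t) u - vdot (nu t) (z i)) (vdot (nu t) (z i)).
  by rewrite subrK; move: th_gt0 tu; lra.
have [f1 fE] : nrm (f i) <= 1 /\ nrm (E *m f i) <= eta.
  have [[->|[s hs ->]] _] := fP i; first by rewrite mulmx0 !nrm0 ler01.
  by rewrite nu1; split=> //; exact: E_thin.
have ftu : th / 4 <= `|vdot (f i) u|.
  have := close (f i) f1; rewrite distrC.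
  have := ler_normD (vdot (f i) (z i) - vdot (f i) u) (vdot (f i) u).
  by rewrite subrK; move: ftz; lra.
have fp : th / 4 * nrm p <= `|vdot (f i) p|.
  have -> : p = nrm p *: u by rewrite scalerA divff ?scale1r ?gt_eqF.
  by rewrite nrmZ u1 mulr1 vdotZr normrM gtr0_norm// mulrC ler_pM2l.
have := vdot_kproj_close EE y fE; rewrite -/p => hc.
have := ler_normD (vdot (f i) p - vdot (f i) y) (vdot (f i) y).
rewrite subrK => hd.
have : `|vdot (f i) y| <= \sum_j `|vdot (f j) y|.
  by rewrite (bigD1 i)//= lerDl sumr_ge0.
by move: fp hc hd; lra.
Qed.


Variables (C beta : R) (C_ge0 : 0 <= C) (beta_ge0 : 0 <= beta).
Hypothesis beta_small : 2 * M * C * beta <= 1 / 2.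
Variables (T' : finType) (om : T' -> 'cV[R]_N).
Hypothesis om_net : forall v, nrm v <= 1 + beta * M ->
  exists k, nrm (v - om k) <= beta * (th / 4).

(** The direction is [nu t + beta *: w0] rounded to the net [om], with [w0]
    from [sum_normals]: [beta] is so small that half of the depth survives, and
    the rounding error is absorbed by the gain of [w0] in [nrm (kproj E y)].
    The heights are measured after projection by [kproj E], since along the rows
    of [E] the direction gains nothing that could absorb that error; the price
    is the term in [eta]. *)
Lemma piece_direction t' t : (a <= t')%N -> (t' <= t)%N -> (t < a')%N ->
    0 <= depth t' t -> len a a' <= C * depth t' t ->
  exists k,
    (forall s, (a' <= s)%N -> vdot (om k) (kproj E (x s - x t')) <=
       - (depth t' t / 2) + (1 + beta + beta * M) * eta * nrm (x s - x t')) /\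
    (forall G s, depth t' t <= G ->
       (forall r, (a <= r < a')%N -> vdot (nu r) (x s - x r) <= G) ->
       vdot (om k) (kproj E (x s - x t')) <= (1 + C) * (1 + 2 * M * beta) * G
         + (1 + beta + beta * M) * eta * nrm (x s - x t')).
Proof.
move=> at' t't ta' dd lenC.
have M0 : 0 <= M by exact: ler0n.
have d0 : 0 <= C * depth t' t by apply: le_trans lenC; exact: len_ge0.
have [w0 [w0M w0E w0P]] := sum_normals.
pose w := nu t + beta *: w0.
have wM : nrm w <= 1 + beta * M.
  by apply: le_trans (nrmD _ _) _; rewrite nu1 lerD2l nrmZ ger0_norm// ler_wpM2l.
have tin : (a <= t < a')%N by rewrite ta' (leq_trans at').
have wE : nrm (E *m w) <= (1 + beta * M) * eta.
  rewrite mulmxDr -scalemxAr; apply: le_trans (nrmD _ _) _.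
  rewrite nrmZ ger0_norm//; have := E_thin tin.
  by have := ler_wpM2l beta_ge0 w0E; lra.
have [k wk] := om_net wM; exists k.
have key y D D0 : 0 <= D -> vdot (nu t) y <= D0 ->
    (forall r, (a <= r < a')%N -> vdot (nu r) y <= D) ->
    vdot (om k) (kproj E y) <= D0 + 2 * M * beta * D
      + (1 + beta + beta * M) * eta * nrm y.
  move=> hD hD0 yD.
  have e1 : vdot (om k) (kproj E y) = vdot w (kproj E y)
      + vdot (om k - w) (kproj E y) by rewrite vdotBl; ring.
  have e2 : vdot (om k - w) (kproj E y) <= beta * (th / 4) * nrm (kproj E y).
    apply: le_trans (vdot_le _ _) _; rewrite ler_wpM2r ?nrm_ge0//.
    by rewrite -nrmN opprB.
  have := vdot_kproj_close EE y wE; rewrite ler_norml => /andP[_ e3].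
  have := ler_wpM2l beta_ge0 (w0P y D hD yD).
  have e4 : vdot w y = vdot (nu t) y + beta * vdot w0 y.
    by rewrite vdotDl vdotZl.
  rewrite e4 in e3; rewrite e1; move: e2 e3 hD0; lra.
have aat r : (a <= r < a')%N -> nrm (x r - x t') <= len a a'.
  move=> /andP[ar ra]; apply: dist_len_window; apply/andP; split=> //.
    exact: ltnW.
  by apply: ltnW; exact: leq_ltn_trans ta'.
have sub s r : x s - x t' = (x s - x r) + (x r - x t') by rewrite addrA subrK.
split=> [s as'|G s dG hG].
- apply: le_trans (key _ (C * depth t' t) (- depth t' t) d0 _ _) _.
  + by apply: future_below; exact: leq_trans as'.
  + move=> r hr; rewrite (sub s r) vdotDr.
    have /andP[_ ra] := hr.
    have := nu_future (leq_trans ra as'); have := mulr_ge0 (ltW c_gt0) (step_ge0 r).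
    have := vdot_nu_le r (x r - x t'); have := aat _ hr; move: lenC; lra.
  + rewrite lerD2r.
    have := ler_wpM2r dd beta_small; lra.
- have G0 : 0 <= G by exact: le_trans dG.
  apply: le_trans (key _ ((1 + C) * G) ((1 + C) * G) _ _ _) _.
  + by rewrite mulr_ge0 ?addr_ge0.
  + rewrite (sub s t) vdotDr; have := hG _ tin; have := vdot_nu_le t (x t - x t').
    have := aat _ tin; have := ler_wpM2l C_ge0 dG; lra.
  + move=> r hr; rewrite (sub s r) vdotDr.
    have := hG _ hr; have := vdot_nu_le r (x r - x t').
    have := aat _ hr; have := ler_wpM2l C_ge0 dG; lra.
  + rewrite lerD2r; lra.
Qed.
End Window.

(** The shortest initial window that is not thin; it is thin up to its last
    step. *)
Lemma first_thick m eta a e : (a < e)%N -> ~ thin m eta a e ->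
  exists l, [/\ (a <= l)%N, (l < e)%N, ~ thin m eta a l.+1 &
                a = l \/ thin m eta a l].
Proof.
move=> ae nthin.
have ex : exists k, (a < k)%N && `[< ~ thin m eta a k >].
  by exists e; rewrite ae; apply/asboolP.
case: (ex_minnP ex) => -[|l] /andP[//]; rewrite ltnS => al /asboolP lthick lmin.
exists l; split => //; first by apply: lmin; rewrite ae; apply/asboolP.
have [->|anl] := eqVneq a l; [by left|right; apply: contrapT => h].
have : (l < l)%N by apply: lmin; rewrite ltn_neqAle anl al; apply/asboolP.
by rewrite ltnn.
Qed.

Lemma depth_diag t : depth t t = c * step t.
Proof. by rewrite /depth subrr vdot0r add0r. Qed.

(** The last step [l] of a piece is not covered by the assumption on thin
    windows, but its length is proportional to the depth [depth l l]. *)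
Lemma piece_depth m eta kap a l : 0 < kap -> deep m eta kap -> (a <= l)%N ->
    a = l \/ thin m eta a l ->
  exists t' t, [/\ (a <= t')%N, (t' <= t)%N, (t < l.+1)%N, 0 <= depth t' t &
                   len a l.+1 <= (kap^-1 + c^-1) * depth t' t].
Proof.
move=> kap0 hdeep al h.
have last : step l = c^-1 * depth l l.
  by rewrite depth_diag mulKf ?gt_eqF.
have dl0 : 0 <= depth l l by rewrite depth_diag mulr_ge0 ?step_ge0 ?ltW.
have k0 : 0 < kap^-1 by rewrite invr_gt0.
have c0 : 0 < c^-1 by rewrite invr_gt0.
rewrite (@len_cat a l l.+1) ?al//= len1 last.
have [eal|nal] := eqVneq a l.
  exists l, l; rewrite eal; split=> //.
  by rewrite /len big_geq// add0r; nra.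
have {h}lthin : thin m eta a l by case: h nal => // ->; rewrite eqxx.
have al' : (a < l)%N by rewrite ltn_neqAle nal.
have [t' [t [at' t't tl dt]]] := hdeep a l al' lthin.
have ll : len a l <= kap^-1 * depth t' t by rewrite ler_pdivlMl.
have [d|d] := leP (depth l l) (depth t' t).
  exists t', t; split=> //; [exact: leq_trans tl _|exact: le_trans dl0 d|].
  by have := ler_wpM2l (ltW c0) d; lra.
exists l, l; split=> //.
by have := ler_wpM2l (ltW k0) (ltW d); lra.
Qed.

(** All constants except [eta] depend only on [eta'], [kap'], [c] and the
    dimension; [eta] is chosen last, small enough to absorb the errors
    proportional to [eta] times the length of the window. *)
Lemma deep_step m eta' kap' : 0 < eta' -> 0 < kap' -> deep m.+1 eta' kap' ->
  exists eta kap, [/\ 0 < eta, 0 < kap & deep m eta kap].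
Proof.
move=> eta'0 kap'0 hdeep.
pose th := eta' / 2; have th0 : 0 < th by rewrite divr_gt0.
have th4 : 0 < th / 4 by rewrite divr_gt0.
have eta'E : eta' = 2 * th by rewrite /th; field.
have [T [z zP]] := finite_net N 1 th4.
pose M : R := #|T|%:R; have M0 : 0 <= M by exact: ler0n.
pose C := kap'^-1 + c^-1.
have k0 : 0 < kap'^-1 by rewrite invr_gt0.
have C0 : 0 < C by rewrite addr_gt0// invr_gt0.
pose beta := 1 / (4 * (M + 1) * C).
have beta0 : 0 < beta.
  by rewrite divr_gt0// !mulr_gt0// ltr_wpDl.
have betaC : 2 * M * C * beta <= 1 / 2.
  have : beta * (4 * (M + 1) * C) = 1.
    by rewrite divfK// gt_eqF// !mulr_gt0// ltr_wpDl.
  by have := mulr_gt0 C0 beta0; lra.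
have [T' [om omP]] := finite_net N (1 + beta * M) (mulr_gt0 beta0 th4).
pose A := 1 + beta + beta * M; pose A2 := (1 + C) * (1 + 2 * M * beta).
pose K : R := #|T'|%:R; have K0 : 0 <= K by exact: ler0n.
have bM0 : 0 <= beta * M by rewrite mulr_ge0// ltW.
have A0 : 0 < A by rewrite /A; lra.
have A20 : 0 < A2 by rewrite mulr_gt0//; lra.
have CKA : 0 <= C * K * A by rewrite !mulr_ge0// ltW.
have W0 : 0 < 8 * (C * K * A) + 1 by lra.
pose eta := Num.min th (1 / (8 * (C * K * A) + 1)).
have eta0 : 0 < eta by rewrite lt_min th0 divr_gt0.
have eta_th : eta <= th by rewrite ge_min lexx.
have eta_small : 4 * (C * K * A) * eta <= 1 / 2.
  have : eta <= 1 / (8 * (C * K * A) + 1) by rewrite ge_min lexx orbT.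
  by rewrite ler_pdivlMr//; have := eta0; lra.
pose C6 := 2 * (C * K * (2 * A2 + 1) + kap'^-1).
have CKA2 : 0 <= C * K * (2 * A2 + 1).
  by rewrite !mulr_ge0// ?(ltW C0)//; lra.
have C60 : 0 < C6 by rewrite /C6; lra.
exists eta, (1 / (2 * C6)); split=> //; first by rewrite divr_gt0// mulr_gt0.
move=> b e be [E [EE Eth]]; apply: contrapT => notdeep.
set l := len b e in notdeep; pose G := 1 / (2 * C6) * l.
have dG t' t : (b <= t')%N -> (t' <= t)%N -> (t < e)%N -> depth t' t < G.
  move=> h1 h2 h3; rewrite ltNge; apply/negP => h4; apply: notdeep.
  by exists t', t; split.
have G0 : 0 < G.
  have := dG b b (leqnn _) (leqnn _) be; apply: le_lt_trans.
  by rewrite depth_diag mulr_ge0 ?step_ge0 ?ltW.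
have lG : l = 2 * C6 * G by rewrite /G; field; rewrite gt_eqF.
pose ph k s := vdot (om k) (kproj E (x s)).
pose Q := A2 * G + G / 2 + A * eta * l.
(* The normals of the window almost support the past points as well. *)
have twoside r s : (b <= r < e)%N -> (b <= s < e)%N ->
    vdot (nu r) (x s - x r) <= G.
  move=> /andP[br re] /andP[bs se]; have := mulr_ge0 (ltW c_gt0) (step_ge0 r).
  have [sr|rs] := leqP s r.
    by have := dG s r bs sr re; rewrite /depth; lra.
  by have := nu_future rs; move: G0; lra.
(* [D k] sums the depths of the pieces of [a, e) that are rounded to [om k].
   The telescoped bound is kept relative to a level [q] near which no point of
   the window [b, e) lies much higher, so that new pieces can be put in front. *)
have sweep a : (b <= a <= e)%N -> exists D : T' -> R, [/\ forall k, 0 <= D k,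
    len a e <= C * (\sum_k D k) + kap'^-1 * G &
    forall k, D k = 0 \/ exists q s, [/\ (a <= s < e)%N,
      D k <= 2 * (ph k s - q) + 2 * A * eta * len s e &
      forall s', (b <= s' < e)%N -> ph k s' - q <= Q]].
  have [n] := ubnP (e - a)%N; elim: n a => // n IHn a ean /andP[ba ae].
  have [{ean}ea|nea] := eqVneq a e.
    exists (fun=> 0); split=> // [|k]; last by left.
    by rewrite ea /len big_geq// big1 ?mulr0// add0r mulr_ge0 ?ltW.
  have {nea ae}ae : (a < e)%N by rewrite ltn_neqAle nea.
  have [athin|athick] := pselect (thin m.+1 eta' a e).
    have [t' [t [at' t't te ht]]] := hdeep a e ae athin.
    exists (fun=> 0); split=> // [|k]; last by left.
    rewrite big1// mulr0 add0r ler_pdivlMl//; apply: le_trans ht _.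
    by apply/ltW/dG => //; exact: leq_trans at'.
  have [j [aj je jthick jthin]] := first_thick ae athick.
  have [t' [t [at' t't tj d0 dC]]] := piece_depth kap'0 hdeep aj jthin.
  have Eth' r : (a <= r < j.+1)%N -> nrm (E *m nu r) <= eta.
    move=> /andP[ar rj]; apply: Eth; rewrite (leq_trans ba ar)/=.
    exact: leq_trans rj je.
  rewrite eta'E in jthick.
  have fat := fat_window EE eta_th th0 Eth' jthick.
  have [k [dir1 dir2]] := piece_direction EE (ltW eta0) th0 Eth' zP fat (ltW C0)
    (ltW beta0) betaC omP at' t't tj d0 dC.
  have jn : (e - j.+1 < n)%N.
    by rewrite -ltnS; apply: leq_trans ean; rewrite ltnS ltn_sub2l.
  have bj : (b <= j.+1 <= e)%N by rewrite je (leq_trans ba) ?leqW.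
  have [D [D0 Dlen Dq]] := IHn j.+1 jn bj.
  have te : (t < e)%N by exact: leq_trans tj je.
  have bt' : (b <= t')%N by exact: leq_trans at'.
  have t'e : (t' < e)%N by exact: leq_ltn_trans te.
  pose d := depth t' t.
  exists (fun i => D i + d * (i == k)%:R); split.
  - by move=> i; rewrite addr_ge0// mulr_ge0.
  - have -> : \sum_i (D i + d * (i == k)%:R) = \sum_i D i + d.
      rewrite big_split /= -mulr_sumr; congr (_ + _).
      rewrite (bigD1 k) //= eqxx big1 ?addr0 ?mulr1// => i /negPf -> //.
    rewrite (@len_cat a j.+1 e) ?je ?(leqW aj)//.
    by rewrite mulrDr; move: dC Dlen; rewrite -/C -/d; lra.
  - move=> i; have [->|ik] := eqVneq i k; last first.
      rewrite mulr0 addr0; have [->|[q [s [/andP[js se] h1 h2]]]] := Dq i; first by left.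
      by right; exists q, s; split=> //; rewrite se (leq_trans _ js) ?leqW.
    rewrite mulr1; right.
    have [Dk|[q [s [/andP[js se] h1 h2]]]] := Dq k.
      exists (ph k t' - d / 2), t'; split.
      + by rewrite at'.
      + have := len_ge0 t' e; rewrite Dk => hl.
        have := mulr_ge0 (mulr_ge0 (ltW A0) (ltW eta0)) hl; lra.
      + move=> s' /andP[bs' s'e].
        have : vdot (om k) (kproj E (x s' - x t')) <= A2 * G + A * eta * nrm (x s' - x t').
          apply: dir2; first by exact/ltW/dG.
          move=> r /andP[ar rj]; apply: twoside; last by rewrite bs'.
          by rewrite (leq_trans ba ar) (leq_trans rj je).
        rewrite kprojB vdotBr -/(ph k s') -/(ph k t').
        have hl : nrm (x s' - x t') <= l.
          by apply: dist_len_window; rewrite ?bs' ?bt' ltnW.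
        have := ler_wpM2l (mulr_ge0 (ltW A0) (ltW eta0)) hl.
        by have := dG _ _ bt' t't te; rewrite /Q -/d; lra.
    exists q, t'; split=> //; first by rewrite at'.
    have := dir1 s js; rewrite kprojB vdotBr -/(ph k s) -/(ph k t') -/d => hd.
    have ts : (t' <= s)%N by apply: leq_trans t't (leq_trans (ltnW tj) js).
    have := ler_wpM2l (mulr_ge0 (ltW A0) (ltW eta0)) (dist_len ts).
    rewrite (@len_cat t' s e) ?ts ?(ltnW se)//.
    have := len_ge0 s e; move: hd h1; rewrite /A; lra.
have [D [D0 Dlen Dq]] := sweep b (introT andP (conj (leqnn _) (ltnW be))).
have DQ k : D k <= 2 * Q + 2 * A * eta * l.
  have Al : 0 <= A * eta * l by rewrite !mulr_ge0 ?len_ge0// ltW.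
  have A2G : 0 <= A2 * G by rewrite mulr_ge0 ?ltW.
  have [->|[q [s [/andP[bs se] h1 h2]]]] := Dq k; first by rewrite /Q; lra.
  have := h2 s; rewrite bs se => /(_ isT) h3.
  have hl : len s e <= l by exact: len_sub (ltnW se) (leqnn _).
  by have := ler_wpM2l (mulr_ge0 (ltW A0) (ltW eta0)) hl; lra.
have sumD : \sum_k D k <= K * (2 * Q + 2 * A * eta * l).
  apply: le_trans (ler_sum _ (fun k _ => DQ k)) _.
  by rewrite sumr_const -[leLHS]mulr_natl.
have := ler_wpM2l (ltW C0) sumD => sumD'.
have : 4 * (C * K * A) * eta * l <= 1 / 2 * l by rewrite ler_wpM2r ?len_ge0.
have : C6 * G = 2 * (C * K * (2 * A2 + 1) * G + kap'^-1 * G) by rewrite /C6; ring.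
move: sumD' Dlen lG (mulr_gt0 C60 G0); rewrite -/l /Q; lra.
Qed.

(** For [m = 0] thinness is no condition at all. *)
Lemma window_deep : exists2 kap, 0 < kap & forall b e, (b < e)%N ->
  exists t' t, [/\ (b <= t')%N, (t' <= t)%N, (t < e)%N &
                   kap * len b e <= depth t' t].
Proof.
have ind k : (k <= N)%N ->
    exists eta kap, [/\ 0 < eta, 0 < kap & deep (N - k) eta kap].
  elim: k => [|k IHk] kN.
    by exists (1 / 2), 1; rewrite subn0; split=> //; exact: deep_full.
  have [eta [kap [eta0 kap0]]] := IHk (ltnW kN).
  rewrite -(subnSK kN) => h; exact: deep_step eta0 kap0 h.
have [eta [kap [eta0 kap0]]] := ind N (leqnn _); rewrite subnn => h.
exists kap => // b e be; apply: h => //; exists 0; split.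
  by apply/matrixP => -[].
by move=> t _; rewrite mul0mx nrm0 ltW.
Qed.

Variable xs : 'cV[R]_N.
Hypothesis nu_target : forall t, vdot (nu t) (xs - x t) <= - (c * step t).

Lemma target_below t' t : depth t' t <= vdot (nu t) (x t' - xs).
Proof.
have -> : x t' - xs = (x t' - x t) - (xs - x t) by rewrite opprB addrA subrK.
by rewrite vdotBr /depth; have := nu_target t; lra.
Qed.

Lemma dist_target_growth t :
  nrm (x t.+1 - xs) <= (1 + c^-1) * nrm (x t - xs).
Proof.
have h : c * step t <= nrm (x t - xs).
  have := vdot_nu_le t (x t - xs); rewrite -(opprB xs) vdotNr.
  by have := nu_target t; rewrite nrmN; lra.
have -> : x t.+1 - xs = (x t - xs) + (x t.+1 - x t).
  by rewrite [RHS]addrC addrA subrK.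
apply: le_trans (nrmD _ _) _; rewrite mulrDl mul1r lerD2l -/(step t).
by rewrite mulrC ler_pdivlMr// mulrC.
Qed.

(** Let [b j] be the first time at distance [L j] from [xs].  Between [b j] and
    [b j.+1] there is a depth of order [L j]; its normal gives the point
    [x (s j).1], which has distance of order [L j], a height of order [L j] above
    [xs], and gives all later points a height at most [L j.+1], which is
    negligible compared with their distances a bounded number of shells
    further. *)
Lemma bounded_path : exists r, forall t, nrm (x t - xs) <= r.
Proof.
have [kap kap0 kapP] := window_deep.
apply: contrapT => unb.
have far r0 : exists t, r0 <= nrm (x t - xs).
  apply: contrapT => h; apply: unb; exists r0 => t.
  by rewrite leNgt; apply/negP => h'; apply: h; exists t; exact: ltW.
pose r t := nrm (x t - xs).
pose q := 1 + c^-1.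
(* One step multiplies the distance to [xs] by at most [q], so no step crosses
   a whole shell. *)
pose Q := 2 * q.
have c'0 : 0 < c^-1 by rewrite invr_gt0.
have q1 : 1 < q by rewrite /q; lra.
have Q0 : 0 < Q by rewrite /Q; lra.
pose L j := Q ^+ j * (r 0%N + 1).
have L0 j : 0 < L j.
  by rewrite mulr_gt0 ?exprn_gt0// ltr_wpDl// nrm_ge0.
have LS j : L j.+1 = Q * L j by rewrite /L exprS mulrA.
have [b bP] : {b : nat -> nat & forall j, L j <= r (b j) /\
    forall t, (t < b j)%N -> r t < L j}.
  apply: (@choice _ _ (fun j k => L j <= r k /\ forall t, (t < k)%N -> r t < L j)) => j.
  have [k hk kmin] := ex_minnP (far (L j)).
  exists k; split=> // t; rewrite ltnNge => tk; rewrite ltNge.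
  by apply: contra tk => ht; apply: kmin.
have b_up j : r (b j) < q * L j.
  have [h1 h2] := bP j; case E : (b j) => [|k].
    have r0 : 0 <= r 0%N by exact: nrm_ge0.
    have : L 0%N <= L j.
      by rewrite ler_wpM2r ?expr0 ?exprn_ege1//; rewrite /Q; lra.
    by rewrite /L expr0 mul1r => h; have := L0 j; rewrite -/(L j) in h *; nra.
  apply: le_lt_trans (dist_target_growth k) _.
  by rewrite ltr_pM2l ?h2 ?E//; lra.
have bS j : (b j < b j.+1)%N.
  rewrite ltnNge; apply/negP => h; have [h1 _] := bP j.+1.
  have : r (b j.+1) < L j.+1.
    move: h; rewrite leq_eqVlt => /orP[/eqP->|h].
      by apply: lt_trans (b_up j) _; rewrite LS ltr_pM2r// /Q; lra.
    apply: lt_trans ((bP j).2 _ h) _; rewrite LS ltr_pMl// /Q; lra.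
  by rewrite ltNge h1.
have b_mono j l : (j <= l)%N -> (b j <= b l)%N.
  by apply: (homo_leq leqnn leq_trans) => {}j; exact: ltnW.
have [s sP] : {s : nat -> nat * nat & forall j, [/\ (b j <= (s j).1)%N,
    ((s j).1 <= (s j).2)%N, ((s j).2 < b j.+1)%N &
    kap * (q * L j) <= depth (s j).1 (s j).2]}.
  apply: (@choice _ _ (fun j s => [/\ (b j <= s.1)%N, (s.1 <= s.2)%N,
    (s.2 < b j.+1)%N & kap * (q * L j) <= depth s.1 s.2])) => j.
  have [t' [t [h1 h2 h3 h4]]] := kapP _ _ (bS j).
  exists (t', t); split=> //; apply: le_trans h4; rewrite ler_pM2l//.
  apply: le_trans (dist_len (ltnW (bS j))).
  have := nrmD (x (b j.+1) - x (b j)) (x (b j) - xs); rewrite addrA subrK.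
  rewrite -/(r (b j)) -/(r (b j.+1)); have := b_up j; have := (bP j.+1).1.
  by rewrite LS /Q; lra.
pose v j := x (s j).1 - xs.
have vlow j : kap * (q * L j) <= vdot (nu (s j).2) (v j).
  by have [_ _ _ h] := sP j; apply: le_trans h _; exact: target_below.
have vup j : nrm (v j) < L j.+1.
  have [_ h1 h2 _] := sP j; apply: (bP j.+1).2; exact: leq_ltn_trans h2.
have kq j : 0 < kap * (q * L j).
  exact: mulr_gt0 kap0 (mulr_gt0 (lt_trans ltr01 q1) (L0 j)).
have nv j : kap * (q * L j) <= nrm (v j).
  exact: le_trans (vlow j) (vdot_nu_le _ _).
have nv0 j : 0 < nrm (v j) by exact: lt_le_trans (nv j).
have vlater j l : (j < l)%N -> vdot (nu (s j).2) (v l) <= L j.+1.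
  move=> jl; have [h1 h2 h3 h4] := sP j; have [k1 _ _ _] := sP l.
  have later : ((s j).2 < (s l).1)%N.
    by apply: leq_trans h3 _; apply: leq_trans k1; exact: b_mono.
  have -> : v l = (x (s l).1 - x (s j).1) + v j by rewrite addrA subrK.
  rewrite vdotDr; have := future_below (s j).1 later.
  have := vdot_nu_le (s j).2 (v j); have := vup j; have := kq j; lra.
pose u j := (nrm (v j))^-1 *: v j.
have u1 j : nrm (u j) = 1.
  by rewrite nrmZ gtr0_norm ?invr_gt0// mulVf ?gt_eqF.
pose B := (Num.trunc (8 / kap ^+ 2)).+1.
have BP j l : (j + B <= l)%N -> kap / 4 <= nrm (u j - u l).
  move=> jl.
  apply: le_trans (vdot_nu_le (s j).2 _); rewrite vdotBr !vdotZr.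
  have p1 : kap / 2 <= (nrm (v j))^-1 * vdot (nu (s j).2) (v j).
    rewrite [leRHS]mulrC ler_pdivlMr//; apply: le_trans (vlow j).
    have := ltW (vup j); rewrite LS /Q => h.
    by have := ler_wpM2l (ltW kap0) h; lra.
  have p2 : (nrm (v l))^-1 * vdot (nu (s j).2) (v l) <= kap / 4.
    rewrite [leLHS]mulrC ler_pdivrMr//.
    apply: le_trans (vlater j l _) _.
      by rewrite (leq_trans _ jl)// -addn1 leq_add2l.
    apply: le_trans (_ : kap / 4 * (kap * (q * L l)) <= _); last first.
      by rewrite ler_pM2l// divr_gt0.
    have : 8 / kap ^+ 2 <= Q ^+ (l - j).
      apply: le_trans (ltW (truncnS_gt _)) _; rewrite -/B.
      have : B%:R <= (2 : R) ^+ B.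
        by rewrite -natrX ler_nat; apply: ltnW; exact: ltn_expl.
      move/le_trans; apply; apply: le_trans (_ : 2 ^+ (l - j) <= _).
        by rewrite ler_eXn2l ?ltr1n// leq_subRL ?(leq_trans (leq_addr _ _) jl).
      by rewrite lerXn2r ?nnegrE ?(ltW Q0)// /Q; lra.
    rewrite ler_pdivrMr ?exprn_gt0// => h.
    have -> : L l = Q ^+ (l - j) * L j.
      by rewrite /L mulrA -exprD subnK ?(leq_trans (leq_addr _ _) jl).
    rewrite LS /Q; have := ler_wpM2r (ltW (mulr_gt0 (lt_trans ltr01 q1) (L0 j))) h.
    lra.
  lra.
have k16 : 0 < kap / 16 by rewrite divr_gt0.
have [T [z zP]] := @finite_net R N 1 (kap / 16) k16.
have [f fP] : {f : 'I_#|T|.+1 -> T &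
    forall i : 'I_#|T|.+1, nrm (u (i * B)%N - z (f i)) <= kap / 16}.
  apply: (@choice _ _ (fun (i : 'I_#|T|.+1) k =>
    nrm (u (i * B)%N - z k) <= kap / 16)) => i.
  by apply: zP; rewrite u1.
have finj : injective f.
  suff wl (i j : 'I_#|T|.+1) : (i < j)%N -> f i <> f j.
    move=> i j fij; apply/eqP/negPn/negP; rewrite neq_ltn.
    by case/orP=> /wl; rewrite fij; apply.
  move=> ij fij; have := BP (i * B)%N (j * B)%N.
  have -> : (i * B + B <= j * B)%N by rewrite -mulSnr leq_mul2r ij orbT.
  move/(_ isT); rewrite -(subrK (z (f i)) (u (i * B)%N)) -addrA.
  move=> h; have := le_trans h (nrmD _ _).
  have := fP i; have := fP j; rewrite -nrmN opprB fij; lra.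
by have := leq_card f finj; rewrite card_ord ltnn.
Qed.

Lemma finite_length : exists l, forall b e, len b e <= l.
Proof.
have [r rP] := bounded_path; have [kap kap0 kapP] := window_deep.
exists (r / kap) => b e; have [eb|be] := leqP e b.
  rewrite /len big_geq//; apply: divr_ge0 (ltW kap0).
  exact: le_trans (nrm_ge0 _) (rP 0%N).
have [t' [t [_ _ _ h]]] := kapP b e be.
rewrite ler_pdivlMr// mulrC; apply: le_trans h _.
apply: le_trans (target_below _ _) _; apply: le_trans (vdot_nu_le _ _) _.
exact: rP.
Qed.

End Descent.

(** * From finite length to the rate *)

Section Rate.
Variables (R : realType) (d ga : nat -> R) (tl : nat -> nat -> R).
Variables (c1 r l : R).
Hypotheses (c1_gt0 : 0 < c1) (r_gt0 : 0 < r).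
Hypothesis d_gt0 : forall t, 0 < d t.
Hypothesis ga_ge0 : forall t, 0 <= ga t.
Hypothesis d_decr : forall t, c1 * ga t ^+ 2 <= d t - d t.+1.

(** Sufficient decrease gives c1 d(t)^2 / b^2 <= d(t) - d(t+1), hence
    1 / d(t+1) - 1 / d(t) >= c1 / b^2. *)
Lemma inv_growth b T : 0 < b -> (forall t, (T <= t)%N -> d t <= ga t * b) ->
  forall k, c1 / b ^+ 2 * k%:R <= (d (T + k)%N)^-1.
Proof.
move=> b0 h; elim=> [|k IHk]; first by rewrite mulr0 invr_ge0 ltW.
rewrite addnS -natr1 mulrDr mulr1.
set t := (T + k)%N in IHk *.
have h1 := h t (leq_addr _ _).
have p1 := d_gt0 t; have p2 := d_gt0 t.+1; have hd := d_decr t.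
have b2 : 0 < b ^+ 2 by rewrite exprn_gt0.
have h2 : c1 / b ^+ 2 * d t ^+ 2 <= d t - d t.+1.
  apply: le_trans hd; rewrite -mulrA ler_pM2l// mulrC ler_pdivrMr// -exprMn.
  by rewrite ler_sqr ?nnegrE ?mulr_ge0// ltW.
have h3 : d t.+1 <= d t.
  by rewrite -subr_ge0; apply: le_trans hd; rewrite mulr_ge0 ?sqr_ge0 ?ltW.
set a := c1 / b ^+ 2 in h2 IHk *.
have a0 : 0 < a by rewrite divr_gt0.
apply: le_trans (_ : (d t)^-1 + a <= _); first by rewrite lerD2r.
rewrite -subr_ge0.
have -> : (d t.+1)^-1 - ((d t)^-1 + a)
    = (d t - d t.+1 - a * d t * d t.+1) / (d t * d t.+1).
  by field; rewrite !gt_eqF.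
apply: divr_ge0; last by rewrite mulr_ge0 ?ltW.
rewrite subr_ge0; apply: le_trans h2; rewrite -mulrA ler_pM2l// expr2.
by rewrite ler_pM2l.
Qed.

Lemma small_eventually b T : 0 < b -> (forall t, (T <= t)%N -> d t <= ga t * b) ->
  forall e, 2 * b ^+ 2 / c1 <= e -> forall t, (2 * T < t)%N -> t%:R * d t <= e.
Proof.
move=> b0 h e he t Tt; apply: le_trans he.
have := inv_growth b0 h (t - T); rewrite subnKC; last by lia.
move=> h1; have t0 : (0 : R) < t%:R by rewrite ltr0n; lia.
have ht : t%:R / 2 <= (t - T)%:R :> R.
  by rewrite ler_pdivrMr// -natrM ler_nat; lia.
have b2 : 0 < b ^+ 2 by rewrite exprn_gt0.
have a0 : 0 < c1 / b ^+ 2 by rewrite divr_gt0.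
have h2 : c1 / b ^+ 2 * (t%:R / 2) <= (d t)^-1.
  by apply: le_trans h1; rewrite ler_pM2l.
rewrite -[d t]invrK ler_pdivrMr ?invr_gt0//.
have -> : t%:R = 2 * b ^+ 2 / c1 * (c1 / b ^+ 2 * (t%:R / 2)).
  by field; rewrite !gt_eqF.
by rewrite ler_pM2l// divr_gt0// mulr_gt0.
Qed.

Hypothesis d_r : forall t, d t <= ga t * r.
Hypothesis tl_cat : forall a b e, (a <= b)%N -> (b <= e)%N ->
  tl a e = tl a b + tl b e.
Hypothesis tl_ge0 : forall a b, 0 <= tl a b.
Hypothesis tl_bound : forall a b, tl a b <= l.
Hypothesis d_len : forall t s, (t <= s)%N -> d t - d s <= ga t * tl t s.

Lemma short_tails e : 0 < e -> exists T, forall t s, (T <= t)%N -> (t <= s)%N ->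
  tl t s <= e.
Proof.
move=> e0.
have hs : has_sup (range (tl 0)).
  split; first by exists (tl 0 0), 0%N.
  by exists l => _ [n _ <-].
have [_ [T _ <-] hT] := sup_adherent e0 hs.
exists T => t s Tt ts.
have h1 := @tl_cat 0%N T t isT Tt.
have h2 := @tl_cat 0%N t s isT ts.
have h3 := tl_ge0 T t.
have : tl 0 s <= sup (range (tl 0)).
  by apply: ub_le_sup; [case: hs|exists s].
by move: hT; lra.
Qed.

(** Since the error tends to 0 along the path, it is bounded by the gradient
    norm times the length still to be travelled, which tends to 0. *)
Lemma little_o_rate e : 0 < e -> exists T, forall t, (T <= t)%N -> t%:R * d t <= e.
Proof.
move=> e0.
have vanish e' : 0 < e' -> forall t, exists2 s, (t <= s)%N & d s <= e'.
  move=> e'0 t; pose E := 2 * r ^+ 2 / c1.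
  have E0 : 0 < E by rewrite divr_gt0// mulr_gt0// exprn_gt0.
  pose s := ((Num.trunc (E / e')).+1 + t)%N.
  have s0 : (2 * 0 < s)%N by rewrite muln0.
  exists s; first exact: leq_addl.
  have := small_eventually r_gt0 (fun t _ => d_r t) (lexx E) s0.
  have : E / e' <= s%:R.
    by apply: le_trans (ltW (truncnS_gt _)) _; rewrite ler_nat leq_addr.
  rewrite ler_pdivrMr// => h1 h2; have := le_trans h2 h1.
  by rewrite ler_pM2l// ltr0n.
pose b := Num.sqrt (e * c1 / 2).
have b0 : 0 < b by rewrite sqrtr_gt0 !mulr_gt0.
have [T hT] := short_tails b0.
have dT t : (T <= t)%N -> d t <= ga t * b.
  move=> Tt; apply/ler_addgt0Pr => e' e'0.
  have [s ts hs] := vanish e' e'0 t.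
  have := d_len ts; have := ler_wpM2l (ga_ge0 t) (hT t s Tt ts); lra.
exists (2 * T).+1; apply: small_eventually b0 dT _ _.
rewrite sqr_sqrtr; last by rewrite !mulr_ge0 ?ltW.
by rewrite le_eqVlt; apply/orP; left; apply/eqP; field; rewrite gt_eqF.
Qed.

End Rate.

(** * Second-order bounds for smooth convex functions *)

Section Calculus.
Variables (R : realType) (N : nat).

Lemma derive_gradient (f : 'cV[R]_N -> R^o) x v : differentiable f x ->
  'D_v f x = vdot (gradient f x) v.
Proof.
move=> fx; rewrite deriveE// vdotE.
have {1}-> : v = \sum_k v k 0 *: delta_mx k 0.
  by rewrite {1}[v]matrix_sum_delta; apply: eq_bigr => k _; rewrite big_ord1.
rewrite linear_sum; apply: eq_bigr => k _.
by rewrite linearZ /gradient mxE deriveE// mulrC.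
Qed.

(** The difference quotient along the line is the directional one. *)
Lemma is_derive_line (f : 'cV[R]_N -> R^o) x v (s : R) :
  differentiable f (x + s *: v) ->
  is_derive s 1 (fun s : R => f (x + s *: v) : R^o) ('D_v f (x + s *: v)).
Proof.
move=> fx; have fv : derivable f (x + s *: v) v by exact: diff_derivable.
have eq : (fun h : R => h^-1 *: (((fun s : R => f (x + s *: v) : R^o) \o shift s)
      (h *: 1) - (f (x + s *: v) : R^o)))
  = (fun h : R => h^-1 *: ((f \o shift (x + s *: v)) (h *: v) - f (x + s *: v))).
  apply/funext => h /=; congr (_ *: (f _ - _)).
  have -> : h *: 1 = h by exact: mulr1.
  by rewrite scalerDl addrCA.
split; first by rewrite /derivable eq.
by rewrite /derive eq.
Qed.


Section Bounds.
Variables (f : 'cV[R]_N -> R^o) (L : R).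
Hypothesis f_diff : forall x, differentiable f x.
Hypothesis g_diff : forall x, differentiable (gradient f) x.
Hypothesis hess_ge : forall y, loewner_le 0 (hessian f y).
Hypothesis hess_le : forall y, loewner_le (hessian f y) L%:M.

Lemma differentiable_gradient_coord k x :
  differentiable (fun y => gradient f y k 0 : R^o) x.
Proof.
exact: (@differentiable_comp _ _ _ _ (gradient f) (fun M : 'cV[R]_N => M k 0 : R^o) x
  (g_diff x) (differentiable_coord _ _ _)).
Qed.

Lemma derive_gradient_dot x v :
  differentiable (fun y => vdot (gradient f y) v : R^o) x /\
  'D_v (fun y => vdot (gradient f y) v : R^o) x = vdot v (hessian f x *m v).
Proof.
have eq : (fun y => vdot (gradient f y) v : R^o)
    = \sum_(k < N) (v k 0 *: (fun y => gradient f y k 0 : R^o)).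
  apply/funext => y; rewrite vdotE fct_sumE; apply: eq_bigr => k _.
  by rewrite mulrC.
have dk k : differentiable (v k 0 *: (fun y => gradient f y k 0 : R^o)) x.
  by apply: differentiableZ; exact: differentiable_gradient_coord.
have df : differentiable (\sum_(k < N) (v k 0 *: (fun y => gradient f y k 0 : R^o))) x.
  exact: differentiable_sum.
rewrite eq; split=> //; rewrite derive_gradient// !vdotE.
under [RHS]eq_bigr => k _ do rewrite mxE mulr_sumr.
rewrite [RHS]exchange_big /=; apply: eq_bigr => l _.
rewrite /gradient mxE derive_sum; last by move=> k; exact: diff_derivable.
rewrite mulr_suml; apply: eq_bigr => k _.
rewrite deriveZ; last exact/diff_derivable/differentiable_gradient_coord.
by rewrite /hessian mxE /GRing.scale /= mulrA.
Qed.

(** Convexity and the descent inequality, both from the mean value theorem on the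
    segment from [x] to [y]. *)
Lemma second_order_bounds x y :
  f x + vdot (gradient f x) (y - x) <= f y <=
  f x + vdot (gradient f x) (y - x) + L / 2 * vdot (y - x) (y - x).
Proof.
set v := y - x.
pose ph (s : R) : R := f (x + s *: v).
pose q (s : R) : R := vdot (gradient f (x + s *: v)) v.
have dph (s : R) : is_derive s 1 (ph : R -> R^o) (q s).
  by rewrite /q -derive_gradient//; exact: is_derive_line.
have dq (s : R) : is_derive s 1 (q : R -> R^o)
    (vdot v (hessian f (x + s *: v) *m v)).
  have [h1 h2] := derive_gradient_dot (x + s *: v) v.
  by rewrite -h2; exact: (@is_derive_line (fun y => vdot (gradient f y) v)).
have cont (h h' : R -> R) a b : (forall s : R, is_derive s 1 (h : R -> R^o) (h' s)) ->
    {within `[a, b], continuous h}.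
  move=> hd; apply: derivable_within_continuous => s _.
  by have [] := hd s.
have qs (s : R) : 0 <= s -> 0 <= q s - q 0 <= L * vdot v v * s.
  move=> s0.
  have [z _ ->] := MVT_segment s0 (fun s _ => dq s) (cont _ _ 0 s dq).
  rewrite subr0; have h1 := hess_ge (x + z *: v) v.
  have h2 := hess_le (x + z *: v) v.
  rewrite subr0 in h1; rewrite mulmxBl vdotBr mul_scalar_mx vdotZr in h2.
  by rewrite mulr_ge0//= ler_wpM2r// -subr_ge0.
have q0 : q 0 = vdot (gradient f x) v by rewrite /q scale0r addr0.
have ph0 : ph 0 = f x by rewrite /ph scale0r addr0.
have ph1 : ph 1 = f y by rewrite /ph scale1r addrC subrK.
apply/andP; split.
  have [z] := MVT_segment ler01 (fun s _ => dph s) (cont _ _ 0 1 dph).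
  rewrite in_itv /= => /andP[z0 _]; rewrite ph0 ph1 subr0 mulr1 => hz.
  by have /andP[h _] := qs z z0; move: h hz; rewrite q0; lra.
pose K := L / 2 * vdot v v.
pose h (s : R) : R := ph s - (q 0 * s + K * s ^+ 2).
have dh (s : R) : is_derive s 1 (h : R -> R^o) (q s - (q 0 + K * (2 * s))).
  rewrite /h; have hs := dph s.
  have h1 : is_derive s 1 (fun t : R => q 0 * t + K * t ^+ 2 : R^o)
      (q 0 + K * (2 * s)).
    apply: is_derive_eq; rewrite /GRing.scale /=; ring.
  exact: is_deriveB.
have [z] := MVT_segment ler01 (fun s _ => dh s) (cont _ _ 0 1 dh).
rewrite in_itv /= => /andP[z0 _]; rewrite /h ph0 ph1 => hz.
by have /andP[_ h1] := qs z z0; move: h1 hz; rewrite q0 /K; lra.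
Qed.
End Bounds.
End Calculus.

(** * Regularized BFGS matrices and the aggregated direction *)

Section QuasiNewton.
Variables (R : realType) (N : nat) (gam : R) (gam_gt0 : 0 < gam).
Implicit Types (B : 'M[R]_N) (u v r w : 'cV[R]_N).

Lemma vdot_symm B u w : B^T = B -> vdot u (B *m w) = vdot w (B *m u).
Proof. by move=> sB; rewrite -{1}sB -vdot_mulmxl vdotC. Qed.

Lemma outer_mulmx u v w : u *m v^T *m w = vdot v w *: u.
Proof. by rewrite -mulmxA [v^T *m w]mx11_scalar mul_mx_scalar. Qed.

Lemma psdmx_CauchySchwarz B u w : B^T = B -> psdmx B ->
  vdot u (B *m w) ^+ 2 <= vdot u (B *m u) * vdot w (B *m w).
Proof.
move=> sB pB; apply: (@form_CauchySchwarz _ _ (fun u w => vdot u (B *m w))).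
- by move=> *; rewrite vdotDl.
- by move=> *; rewrite vdotZl.
- by move=> *; exact: vdot_symm.
- exact: pB.
Qed.

Lemma psdmx_invmx B : B \in unitmx -> B^T = B -> psdmx (invmx B) -> psdmx B.
Proof.
move=> uB sB pB u; have := pB (B *m u).
by rewrite mulKmx// vdotC.
Qed.

Lemma bfgs_update_sym B v r : B^T = B ->
  (bfgs_update gam B v r)^T = bfgs_update gam B v r.
Proof.
move=> sB; rewrite /bfgs_update !linearD/= !linearN/= !linearZ/=.
by rewrite !trmx_mul !trmxK sB tr_scalar_mx !mulmxA.
Qed.

(** Without the last term the update keeps positive semidefiniteness, by the
    Cauchy-Schwarz inequality for B. *)
Lemma bfgs_update_ge B v r u : B^T = B -> psdmx B -> 0 < vdot r v ->
  gam * vdot u u <= vdot u (bfgs_update gam B v r *m u).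
Proof.
move=> sB pB rv; rewrite /bfgs_update !mulmxDl mulNmx -!scalemxAl.
have -> : B *m v *m v^T *m B *m u = vdot v (B *m u) *: (B *m v).
  by rewrite -(mulmxA _ B u) outer_mulmx.
rewrite outer_mulmx mul_scalar_mx !(vdotDr, vdotNr, vdotZr) lerDr.
rewrite (vdotC u r) (vdot_symm v u sB).
have h1 : 0 <= (vdot r v)^-1 * (vdot r u * vdot r u).
  by apply: mulr_ge0; [rewrite invr_ge0 ltW|rewrite -expr2 sqr_ge0].
suff : (vdot v (B *m v))^-1 * (vdot u (B *m v) * vdot u (B *m v))
    <= vdot u (B *m u) by lra.
have [->|v0] := eqVneq (vdot v (B *m v)) 0; first by rewrite invr0 mul0r pB.
rewrite mulrC ler_pdivrMr; last by rewrite lt_def v0 pB.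
by rewrite -expr2 psdmx_CauchySchwarz.
Qed.

Section Inverse.
Variable B : 'M[R]_N.
Hypotheses (sB : B^T = B) (B_ge : forall u, gam * vdot u u <= vdot u (B *m u)).

Lemma unitmx_coercive : B \in unitmx.
Proof.
rewrite -row_free_unit -kermx_eq0; apply/rowV0P => w /sub_kermxP wB.
apply: trmx_inj; rewrite trmx0; apply: vdot_eq0.
have Bw : B *m w^T = 0 by rewrite -{1}sB -trmx_mul wB trmx0.
have := B_ge w^T; rewrite Bw vdot0r pmulr_rle0// => h.
by apply/eqP; rewrite eq_le h vdot_ge0.
Qed.

Lemma invmx_sym : (invmx B)^T = invmx B.
Proof. by rewrite trmx_inv sB. Qed.

Lemma invmx_quad_ge : psdmx (invmx B).
Proof.
move=> u; have := B_ge (invmx B *m u).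
rewrite mulKVmx ?unitmx_coercive// vdotC; apply: le_trans.
by rewrite mulr_ge0 ?vdot_ge0 ?ltW.
Qed.

Lemma invmx_quad_le u : vdot u (invmx B *m u) <= gam^-1 * vdot u u.
Proof.
set w := invmx B *m u.
have h1 : gam * vdot w w <= vdot u w.
  by have := B_ge w; rewrite /w mulKVmx ?unitmx_coercive// (vdotC _ u).
rewrite ler_pdivlMl//.
have h2 := vdot_CauchySchwarz u w; have := vdot_ge0 w; have := vdot_ge0 u.
have [->|n0] := eqVneq (vdot u w) 0; first by rewrite mulr0.
have uw : 0 < vdot u w by rewrite lt_def n0 invmx_quad_ge.
move=> u0 w0; rewrite -(ler_pM2r uw).
apply: le_trans (_ : vdot u u * (gam * vdot w w) <= _).
  by have := ler_wpM2l (ltW gam_gt0) h2; lra.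
by rewrite ler_wpM2l.
Qed.

End Inverse.
End QuasiNewton.

Section Blocks.
Variables (R : realType) (n p : nat).
Implicit Types (S : {set 'I_n}) (u w : 'cV[R]_(bdim n p)).

Lemma vdot_mxcol k (F G : 'I_k -> 'cV[R]_p) :
  vdot (\mxcol_(a < k) F a) (\mxcol_(a < k) G a) = \sum_a vdot (F a) (G a).
Proof. by rewrite /vdot tr_mxcol mul_mxrow_mxcol summxE. Qed.

Lemma vdot_blocks k (u w : 'cV[R]_(bdim k p)) :
  vdot u w = \sum_i vdot (submxcol u i) (submxcol w i).
Proof. by rewrite -{1}(submxcolK u) -{1}(submxcolK w) vdot_mxcol. Qed.

Lemma subvec_block S u a : submxcol (subvec S u) a = submxcol u (enum_val a).
Proof. by rewrite /subvec mxcolK. Qed.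

Lemma subvecD S u w : subvec S (u + w) = subvec S u + subvec S w.
Proof.
apply/mxcolP => a; rewrite submxcolD !subvec_block.
exact: submxcolD.
Qed.

Lemma subvecZ S (c : R) u : subvec S (c *: u) = c *: subvec S u.
Proof. by apply/matrixP => i j; rewrite !mxE. Qed.

Lemma vdot_subvec_le S u : vdot (subvec S u) (subvec S u) <= vdot u u.
Proof.
rewrite !vdot_blocks.
under eq_bigr => a _ do rewrite subvec_block.
rewrite -(big_enum_val (fun i => vdot (submxcol u i) (submxcol u i))).
rewrite [leRHS](bigID (mem S))/= lerDl sumr_ge0// => i _; exact: vdot_ge0.
Qed.

Variable E : rel 'I_n.
Hypothesis sE : symmetric E.

Lemma nbhd_sym i j : (i \in nbhd E j) = (j \in nbhd E i).
Proof. by rewrite !inE eq_sym sE. Qed.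

Lemma submat_Dmat S u : submat S (Dmat R p E) *m subvec S u =
  \mxcol_(a < #|S|) ((nbhd_size E (enum_val a))%:R^-1 *: submxcol u (enum_val a)).
Proof.
have -> : submat S (Dmat R p E) =
    \mxdiag_(a < #|S|) ((nbhd_size E (enum_val a))%:R^-1)%:M.
  apply: eq_mxblock => a b; rewrite /Dmat mxblockK.
  by rewrite (inj_eq enum_val_inj) !conform_mx_id.
rewrite mul_mxdiag_mxcol; apply: eq_mxcol => a; exact: mul_scalar_mx.
Qed.

(** The weights 1/m_i exactly compensate the m_i neighbourhoods that contain
    the node i. *)
Lemma sum_Dmat u w :
  \sum_j vdot (subvec (nbhd E j) u)
              (submat (nbhd E j) (Dmat R p E) *m subvec (nbhd E j) w) = vdot u w.
Proof.
pose F i := (nbhd_size E i)%:R^-1 * vdot (submxcol u i) (submxcol w i).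
transitivity (\sum_j \sum_(i in nbhd E j) F i).
  apply: eq_bigr => j _; rewrite submat_Dmat vdot_mxcol [RHS]big_enum_val.
  by apply: eq_bigr => a _; rewrite vdotZr.
rewrite (exchange_big_dep predT)//= vdot_blocks; apply: eq_bigr => i _.
rewrite (eq_bigl (mem (nbhd E i))); last by move=> j; rewrite nbhd_sym.
rewrite sumr_const -mulr_natl /F mulrA mulfV ?mul1r// pnatr_eq0.
by rewrite -lt0n; apply/card_gt0P; exists i; rewrite !inE eqxx.
Qed.

Section Metric.
Variables (gam Gam : R) (gam_gt0 : 0 < gam) (Gam_gt0 : 0 < Gam).
Variable B : forall i, 'M[R]_(bdim #|nbhd E i| p).
Hypothesis B_sym : forall i, (B i)^T = B i.
Hypothesis B_ge : forall i (u : 'cV[R]_(bdim #|nbhd E i| p)),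
  gam * vdot u u <= vdot u (B i *m u).

(** The bilinear form of the matrix that maps the gradient to minus the descent
    direction. *)
Definition dform u w : R :=
  \sum_j vdot (subvec (nbhd E j) u) (invmx (B j) *m subvec (nbhd E j) w)
    + Gam * vdot u w.

Lemma dform_ge u : Gam * vdot u u <= dform u u.
Proof.
rewrite /dform lerDr sumr_ge0// => j _; exact: (invmx_quad_ge gam_gt0).
Qed.

Lemma dform_le u : dform u u <= (Gam + n%:R / gam) * vdot u u.
Proof.
rewrite mulrDl [leRHS]addrC lerD2r.
apply: le_trans (ler_sum _ (fun j _ => invmx_quad_le gam_gt0 (B_sym j) (@B_ge j) _)) _.
rewrite -mulr_sumr (mulrC n%:R) -mulrA ler_pM2l ?invr_gt0//.
apply: le_trans (ler_sum _ (fun j _ => vdot_subvec_le _ u)) _.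
by rewrite sumr_const card_ord -[leLHS]mulr_natl.
Qed.

Lemma dform_CauchySchwarz u w : dform u w ^+ 2 <= dform u u * dform w w.
Proof.
apply: form_CauchySchwarz.
- move=> a b c; rewrite /dform vdotDl mulrDr addrACA -big_split /=; congr (_ + _).
  by apply: eq_bigr => j _; rewrite subvecD vdotDl.
- move=> c a b; rewrite /dform vdotZl mulrDr mulr_sumr mulrCA; congr (_ + _).
  by apply: eq_bigr => j _; rewrite subvecZ vdotZl.
- move=> a b; rewrite /dform vdotC; congr (_ + _); apply: eq_bigr => j _.
  by apply: vdot_symm; exact: invmx_sym.
- move=> a; apply: le_trans (dform_ge a).
  by rewrite mulr_ge0 ?vdot_ge0 ?ltW.
Qed.

(** The contribution of node j to the blocks of its neighbours is the local
    direction of j tested against the restriction of [u]; that i receives from j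
    exactly when i belongs to the neighbourhood of j is the symmetry of the
    graph. *)
Lemma vdot_descent_dir u g d :
  (forall i, submxcol d i = descent_dir Gam g B i) -> vdot u d = - dform u g.
Proof.
move=> dE; rewrite vdot_blocks.
transitivity (\sum_j vdot (subvec (nbhd E j) u) (local_dir Gam g (B j))).
  transitivity (\sum_i \sum_(j in nbhd E i) \sum_(a < #|nbhd E j| | enum_val a == i)
      vdot (submxcol u i) (submxcol (local_dir Gam g (B j)) a)).
    apply: eq_bigr => i _; rewrite dE /descent_dir vdot_sumr.
    by apply: eq_bigr => j _; rewrite /node_block vdot_sumr.
  rewrite (exchange_big_dep predT)//=; apply: eq_bigr => j _.
  rewrite (exchange_big_dep predT)//= vdot_blocks; apply: eq_bigr => a _.
  rewrite subvec_block (big_pred1 (enum_val a))// => i /=.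
  rewrite eq_sym; have [->|] := eqVneq i (enum_val a); rewrite ?andbT ?andbF//.
  by rewrite nbhd_sym enum_valP.
rewrite /dform -(sum_Dmat u g) mulr_sumr -big_split /= -sumrN.
apply: eq_bigr => j _.
by rewrite /local_dir mulmxDl -scalemxAl vdotNr vdotDr vdotZr.
Qed.

(** The second bound is sharper than |d| <= (Gam + n / gam) |g|: it is what makes
    the decrease uniform for stepsizes arbitrarily close to the allowed
    maximum. *)
Lemma descent_dir_bounds g d :
    (forall i, submxcol d i = descent_dir Gam g B i) ->
  Gam * vdot g g <= - vdot g d /\
  vdot d d <= (Gam + n%:R / gam) * - vdot g d.
Proof.
move=> dE; rewrite (vdot_descent_dir g dE) opprK; split; first exact: dform_ge.
have D0 : 0 < Gam + n%:R / gam.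
  by rewrite ltr_wpDr// divr_ge0// ltW.
have g0 : 0 <= dform g g.
  by apply: le_trans (dform_ge g); rewrite mulr_ge0 ?vdot_ge0 ?ltW.
have := dform_CauchySchwarz d g.
have := dform_le d; have dd := vdot_descent_dir d dE.
rewrite -[dform d g]opprK -dd sqrrN => h1 h2.
have [->|n0] := eqVneq (vdot d d) 0; first by rewrite mulr_ge0// ltW.
have d0 : 0 < vdot d d by rewrite lt_def n0 vdot_ge0.
rewrite -(ler_pM2r d0) -expr2; apply: le_trans h2 _.
by have := ler_wpM2r g0 h1; lra.
Qed.

End Metric.
End Blocks.

(** * Convergence rate *)

(** Sufficient decrease and steps of length O(|g|) are enough, whatever the
    directions of the steps.  An iterate that is already a minimizer is treated
    apart, since it has no normalized gradient. *)
Lemma descent_rate (R : realType) (N : nat) (f : 'cV[R]_N -> R)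
    (g : 'cV[R]_N -> 'cV[R]_N) (xs : 'cV[R]_N) (y : nat -> 'cV[R]_N) (c1 C2 : R) :
    0 < c1 -> 0 < C2 ->
    (forall u w, f u + vdot (g u) (w - u) <= f w) -> (forall u, f xs <= f u) ->
    (forall t, c1 * nrm (g (y t)) ^+ 2 <= f (y t) - f (y t.+1)) ->
    (forall t, nrm (y t.+1 - y t) <= C2 * nrm (g (y t))) ->
  forall e, 0 < e -> exists T, forall t, (T <= t)%N ->
    t%:R * (f (y t) - f xs) <= e.
Proof.
move=> c10 C20 cvx fmin decr short e e0.
have f_mono t s : (t <= s)%N -> f (y s) <= f (y t).
  move: t s.
  apply: (@homo_leq R (fun t => f (y t)) (fun a b => b <= a)) => [a //|a b c ab|i].
    by move/le_trans; apply.
  rewrite -subr_ge0; apply: le_trans (decr i).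
  by rewrite mulr_ge0 ?sqr_ge0 ?ltW.
have [[t0 ft0]|pos] := pselect (exists t0, f (y t0) = f xs).
  exists t0 => t tt0; have -> : f (y t) = f xs.
    by apply/eqP; rewrite eq_le fmin andbT -ft0 f_mono.
  by rewrite subrr mulr0 ltW.
pose d t := f (y t) - f xs.
have d0 t : 0 < d t.
  rewrite subr_gt0 lt_def fmin andbT; apply/negP => /eqP h.
  by apply: pos; exists t.
pose ga t := nrm (g (y t)).
have ga0 t : 0 < ga t.
  rewrite lt_def nrm_ge0 andbT; apply/negP => /eqP /nrm_eq0 h.
  by have := cvx (y t) xs; rewrite h vdot0l addr0; have := d0 t; rewrite /d; lra.
pose nu t := (ga t)^-1 *: g (y t).
have nu1 t : nrm (nu t) = 1.
  by rewrite nrmZ gtr0_norm ?invr_gt0// mulVf ?gt_eqF.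
pose c := c1 / C2.
have c0 : 0 < c by rewrite divr_gt0.
have below t w : f w <= f (y t.+1) -> vdot (nu t) (w - y t) <= - (c * step y t).
  move=> fw; rewrite vdotZl mulrC ler_pdivrMr//.
  have h1 : c * step y t <= c1 * ga t.
    apply: le_trans (ler_wpM2l (ltW c0) (short t)) _.
    by rewrite mulrA /c divfK ?gt_eqF.
  have h2 := ler_wpM2r (ltW (ga0 t)) h1.
  by have := cvx (y t) w; have := decr t; rewrite -/(ga t); lra.
have nu_future t s : (t < s)%N -> vdot (nu t) (y s - y t) <= - (c * step y t).
  by move=> ts; apply: below; exact: f_mono.
have nu_target t : vdot (nu t) (xs - y t) <= - (c * step y t).
  by apply: below; exact: fmin.
have [r rP] := bounded_path c0 nu1 nu_future nu_target.
have [l lP] := finite_length c0 nu1 nu_future nu_target.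
have r0 : 0 < r + 1 by rewrite ltr_wpDl// (le_trans (nrm_ge0 _) (rP 0%N)).
have vdot_ga t w : - vdot (g (y t)) w <= ga t * nrm w.
  by rewrite -vdotNr; apply: le_trans (vdot_le _ _) _; rewrite nrmN.
apply: (@little_o_rate R d ga (len y) c1 (r + 1) l) => //.
- by move=> t; exact: ltW.
- by move=> t; have := decr t; rewrite /d /ga; lra.
- move=> t; have := cvx (y t) xs; have := vdot_ga t (xs - y t).
  rewrite -(nrmN (xs - y t)) opprB.
  have := ler_wpM2l (ltW (ga0 t)) (rP t); have := ga0 t; rewrite /d; lra.
- by move=> a b i ab bi; rewrite -len_cat ?ab.
- by move=> *; exact: len_ge0.
- move=> t s ts; have := cvx (y t) (y s); have := vdot_ga t (y s - y t).
  have := ler_wpM2l (ltW (ga0 t)) (dist_len y ts); rewrite /d; lra.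
Qed.

(** The index is [t.+1] because the initial matrices need not dominate gam I; the
    term gam I enters with the first update. *)
Lemma bfgs_invariant (R : realType) (n p : nat) (E : rel 'I_n)
    (f : 'cV[R]_(bdim n p) -> R^o) (gam Gam : R) (eps : nat -> R)
    (x : nat -> 'cV[R]_(bdim n p))
    (B : nat -> forall i : 'I_n, 'M[R]_(bdim #|nbhd E i| p)) :
    0 < gam -> DBFGS_iterates f gam Gam eps x B ->
    (forall t i, 0 < vdot (vtilde E x t i) (rtilde E f gam x t i)) ->
  forall t i, (B t.+1 i)^T = B t.+1 i /\
    forall u, gam * vdot u u <= vdot u (B t.+1 i *m u).
Proof.
move=> gam0 [B0 iter] vr.
have next t i : (B t i)^T = B t i -> psdmx (B t i) ->
    (B t.+1 i)^T = B t.+1 i /\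
    forall u, gam * vdot u u <= vdot u (B t.+1 i *m u).
  move=> sB pB; rewrite (iter t i).2; split; first exact: bfgs_update_sym.
  by move=> u; apply: bfgs_update_ge => //; rewrite vdotC.
suff h t i : (B t i)^T = B t i /\ psdmx (B t i).
  by move=> t i; have [h1 h2] := h t i; exact: next.
elim: t => [|t [h1 h2]].
  by have [s u q] := B0 i; split=> //; exact: psdmx_invmx.
have [s q] := next t i h1 h2; split=> // u; apply: le_trans (q u).
by rewrite mulr_ge0 ?vdot_ge0 ?ltW.
Qed.

Theorem theorem1 (R : realType) (n p : nat) (E : rel 'I_n)
    (hE : symmetric E)
    (f : 'cV[R]_(bdim n p) -> R^o)
    (hloc : forall (i : 'I_n) (y z : 'cV[R]_(bdim n p)),
        subvec (nbhd E i) y = subvec (nbhd E i) z ->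
        submxcol (gradient f y) i = submxcol (gradient f z) i)
    (xs : 'cV[R]_(bdim n p)) (hxs : forall y, f xs <= f y)
    (L gam Gam : R) (hL : 0 < L) (hgam : 0 < gam) (hGam : 0 < Gam)
    (hf : twice_differentiable f)
    (hH : forall y, loewner_le 0 (hessian f y) /\
                    loewner_le (hessian f y) L%:M)
    (eps : nat -> R)
    (x : nat -> 'cV[R]_(bdim n p))
    (B : nat -> forall i : 'I_n, 'M[R]_(bdim #|nbhd E i| p))
    (hxB : DBFGS_iterates f gam Gam eps x B)
    (hvr : forall (t : nat) (i : 'I_n),
        0 < vdot (vtilde E x t i) (rtilde E f gam x t i))
    (Delta : R) (hDelta : Delta = Gam + n%:R / gam)
    (heps_pos : exists2 eps0 : R, 0 < eps0 & forall t, eps0 <= eps t)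
    (heps_lt : forall t, eps t < 2 * Gam / (L * Delta ^+ 2)) :
  (fun t : nat => f (x t) - f xs) =o_\oo (fun t : nat => (t%:R^-1 : R^o)).
Proof.
have [fd gd] := hf; have [e0 e00 eps_ge] := heps_pos.
have bounds := second_order_bounds fd gd (fun y => (hH y).1) (fun y => (hH y).2).
have inv := bfgs_invariant hgam hxB hvr.
pose g := gradient f.
(* The path is followed from [x 1] on, where [inv] holds. *)
suff rate e : 0 < e -> exists T, forall t, (T <= t)%N ->
    t%:R * (f (x t.+1) - f xs) <= e.
  apply/eqoP => e e_gt0.
  have e2 : 0 < e / 2 by rewrite divr_gt0.
  have [T TP] := rate _ e2.
  exists T.+2 => // t /= Tt; case: t Tt => // t Tt.
  have d0 : 0 <= f (x t.+1) - f xs by rewrite subr_ge0.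
  have t0 : (0 : R) < t.+1%:R by rewrite ltr0n.
  rewrite (ger0_norm d0) (_ : `|_| = t.+1%:R^-1); last first.
    by apply: ger0_norm; rewrite invr_ge0 ltW.
  rewrite -[leRHS]/(e / t.+1%:R) ler_pdivlMr//.
  have t1 : (1 : R) <= t%:R by rewrite ler1n; exact: (@leq_trans T.+1).
  have := TP t (ltnW Tt); have := ler_peMl d0 t1.
  by rewrite -(natr1 t); lra.
have [n0|n_gt0] := posnP n.
  move=> e_gt0; exists 0%N => t _; have -> : x t.+1 = xs.
    by apply/mxcolP => -[i i_lt]; exfalso; move: i_lt; rewrite n0.
  by rewrite subrr mulr0 ltW.
have K0 : 0 < n%:R / gam by rewrite divr_gt0// ltr0n.
have D0 : 0 < Delta by rewrite hDelta addr_gt0.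
pose d t := \mxcol_i descent_dir Gam (g (x t)) (B t) i.
have stepE t : x t.+1 - x t = eps t *: d t.
  apply/eqP; rewrite subr_eq addrC; apply/eqP/mxcolP => i.
  rewrite submxcolD (hxB.2 t i).1; congr (_ + _).
  rewrite -(mxcolK (fun i => descent_dir Gam (g (x t)) (B t) i) i).
  by apply/matrixP => a b; rewrite !mxE.
have dirP t : Gam * vdot (g (x t.+1)) (g (x t.+1)) <= - vdot (g (x t.+1)) (d t.+1) /\
    vdot (d t.+1) (d t.+1) <= Delta * - vdot (g (x t.+1)) (d t.+1).
  rewrite hDelta; apply: (descent_dir_bounds hE hgam hGam (B := B t.+1)).
  - by move=> i; have [] := inv t i.
  - by move=> i; have [] := inv t i.
  - by move=> i; rewrite /d mxcolK.
pose c1 := e0 * Gam * (n%:R / gam / Delta).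
pose C2 := 2 * Gam / (L * Delta).
apply: (@descent_rate R (bdim n p) f g xs (fun t => x t.+1) c1 C2) => //.
- exact: mulr_gt0 (mulr_gt0 e00 hGam) (divr_gt0 K0 D0).
- by apply: divr_gt0; exact: mulr_gt0.
- by move=> u w; have /andP[] := bounds u w.
- move=> t; have /andP[_] := bounds (x t.+1) (x t.+2).
  rewrite stepE vdotZl !vdotZr nrm_sqr -/g.
  have [h1 h2] := dirP t; have := eps_ge t.+1; have := heps_lt t.+1.
  set h := eps t.+1; set Q := - vdot _ _ in h1 h2 *.
  have -> : vdot (g (x t.+1)) (d t.+1) = - Q by rewrite opprK.
  rewrite ltr_pdivlMr ?mulr_gt0 ?exprn_gt0// => e_lt e_ge hf1.
  pose k := n%:R / gam / Delta.
  have k0 : 0 < k by rewrite divr_gt0.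
  have GD : Gam = Delta * (1 - k).
    have -> : Delta * (1 - k) = Delta - k * Delta by ring.
    by rewrite /k divfK ?gt_eqF// hDelta addrK.
  have e_gt0 : 0 < h by exact: lt_le_trans e_ge.
  have Q0 : 0 <= Q by apply: le_trans h1; rewrite mulr_ge0 ?vdot_ge0 ?ltW.
  have A1 : L / 2 * h * Delta <= 1 - k.
    rewrite -(ler_pM2l D0) -GD; move: (ltW e_lt); rewrite expr2; lra.
  have a1 : L / 2 * h * vdot (d t.+1) (d t.+1) <= (1 - k) * Q.
    apply: le_trans (_ : L / 2 * h * (Delta * Q) <= _).
      by rewrite ler_pM2l// !mulr_gt0// invr_gt0.
    by rewrite mulrA ler_wpM2r.
  have a2 := ler_wpM2l (ltW e_gt0) a1.
  have a3 : e0 * k * (Gam * vdot (g (x t.+1)) (g (x t.+1))) <= h * k * Q.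
    apply: ler_pM => //; rewrite ?ler_pM2r//.
      by rewrite mulr_ge0 ?ltW.
    by rewrite mulr_ge0 ?vdot_ge0 ?ltW.
  move: hf1 a2 a3; rewrite /c1 -/k; lra.
- move=> t; rewrite stepE nrmZ ger0_norm; last exact: le_trans (ltW e00) (eps_ge _).
  have [_ h2] := dirP t.
  have dg : nrm (d t.+1) <= Delta * nrm (g (x t.+1)).
    have [->|d_neq0] := eqVneq (nrm (d t.+1)) 0.
      by rewrite mulr_ge0 ?nrm_ge0 ?ltW.
    have d_gt0 : 0 < nrm (d t.+1) by rewrite lt_def d_neq0 nrm_ge0.
    rewrite -(ler_pM2r d_gt0) -expr2 nrm_sqr; apply: le_trans h2 _.
    rewrite -mulrA ler_pM2l// -vdotNr; apply: le_trans (vdot_le _ _) _.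
    by rewrite nrmN.
  have -> : C2 = 2 * Gam / (L * Delta ^+ 2) * Delta.
    by rewrite /C2; field; rewrite !gt_eqF.
  rewrite -mulrA; apply: ler_pM => //; [|exact: nrm_ge0|exact/ltW/heps_lt].
  exact: le_trans (ltW e00) (eps_ge _).
Qed.
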